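(* Let $X$ be a nonrigid trinomial hypersurface. Then the number of $\mathrm{Aut}_{alg}(X)$-orbits on $X$ is finite.
   Context: $\mathbb{K}$ is an algebraically closed field of characteristic zero. Fix $n=n_0+n_1+n_2$ with $n_0\ge 0$ and $n_1,n_2\ge 1$ integers, and let $T_{ij}$ ($i\in\{0,1,2\}$, $1\le j\le n_i$) be the coordinates on $\mathbb{K}^n$. A trinomial hypersurface is a subvariety $X\subset\mathbb{K}^n$ given by the equation $T_0^{l_0}+T_1^{l_1}+T_2^{l_2}=0$, where $T_i^{l_i}=T_{i1}^{l_{i1}}T_{i2}^{l_{i2}}\cdots T_{in_i}^{l_{in_i}}$ and all $l_{ij}$ are positive integers; if $n_0=0$, then $T_0^{l_0}$ means $1$. Such $X$ is an irreducible normal affine variety. A derivation $\partial$ of an algebra $A$ is locally nilpotent (an LND) if for every $a\in A$ there is $n\ge1$ with $\partial^n(a)=0$. An affine variety $X$ is rigid if $\mathbb{K}[X]$ admits no nonzero LND. $\mathrm{Aut}(X)$ is the group of all regular automorphisms of $X$ and $\mathrm{Aut}_{alg}(X)$ is the subgroup of $\mathrm{Aut}(X)$ generated by all connected algebraic subgroups of $\mathrm{Aut}(X)$ (equivalently, by all one-parameter subgroups isomorphic to $(\mathbb{K},+)$ or $(\mathbb{K}^\times,\cdot)$ acting algebraically on $X$). *)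

(* Defs.v *)
From HB Require Import structures.
From mathcomp Require Import all_boot all_order all_algebra.
From mathcomp Require Import mpoly.
From mathcomp Require Import boolp classical_sets functions cardinality.

Set Implicit Arguments.
Unset Strict Implicit.
Unset Printing Implicit Defensive.

Import GRing.Theory.
Local Open Scope ring_scope.
Local Open Scope classical_set_scope.

Section AffineVarieties.
Variable K : closedFieldType.

Definition vanish n (s : seq {mpoly K[n]}) (x : 'I_n -> K) : bool :=
  all (fun p => p.@[x] == 0) s.

(* Affine algebraic sets of K^n are presented by finitely many equations; by
   Hilbert's basis theorem these are all the Zariski-closed subsets. *)
Record affvar := AffVar { adim : nat; aeqs : seq {mpoly K[adim]} }.

Definition apoint (X : affvar) : Type :=
  {x : {ffun 'I_(adim X) -> K} | vanish (aeqs X) x}.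
Coercion apoint : affvar >-> Sortclass.

Definition regular_fun (X : affvar) (f : X -> K) : Prop :=
  exists p : {mpoly K[adim X]}, forall x : X, f x = p.@[val x].

Definition regular_map (X Y : affvar) (f : X -> Y) : Prop :=
  forall k, regular_fun (fun x => val (f x) k).

(* Regular maps on X * Y, which is viewed as a closed subset of
   K^(adim X + adim Y) through the concatenation of coordinates. *)
Definition concat m n (x : 'I_m -> K) (y : 'I_n -> K) (k : 'I_(m + n)) : K :=
  match fintype.split k with inl i => x i | inr j => y j end.

Definition regular_map2 (X Y Z : affvar) (f : X -> Y -> Z) : Prop :=
  forall k, exists p : {mpoly K[adim X + adim Y]},
    forall (x : X) (y : Y), val (f x y) k = p.@[concat (val x) (val y)].

Definition zariski_connected (X : affvar) : Prop :=
  forall s t : seq {mpoly K[adim X]},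
    (forall x : X, vanish s (val x) || vanish t (val x)) ->
    (forall x : X, ~~ (vanish s (val x) && vanish t (val x))) ->
    (forall x : X, vanish s (val x)) \/ (forall x : X, vanish t (val x)).

Section CoordinateRing.
Variable X : affvar.

Definition regular_pred : {pred X -> K^o} := fun f => `[< regular_fun f >].

Lemma regular_subring : subring_closed regular_pred.
Proof.
split=> [|f g /asboolP[p fp] /asboolP[q gq]|f g /asboolP[p fp] /asboolP[q gq]];
  apply/asboolP.
- by exists 1 => x; rewrite meval1.
- by exists (p - q) => x; rewrite mevalB -fp -gq.
- by exists (p * q) => x; rewrite mevalM -fp -gq.
Qed.

Lemma regular_scaler : GRing.scaler_closed regular_pred.
Proof.
by move=> a f /asboolP[p fp]; apply/asboolP; exists (a *: p) => x;
  rewrite mevalZ -fp.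
Qed.

HB.instance Definition _ :=
  GRing.isSubringClosed.Build (X -> K^o) regular_pred regular_subring.
HB.instance Definition _ :=
  GRing.isScaleClosed.Build K (X -> K^o) regular_pred regular_scaler.

(* K[X], as the K-algebra of regular functions on X. *)
Record coord_ring := RegFun { regfun : X -> K^o; _ : regfun \in regular_pred }.

HB.instance Definition _ := [isSub for regfun].
HB.instance Definition _ := [Choice of coord_ring by <:].
HB.instance Definition _ :=
  GRing.SubChoice_isSubComPzRing.Build _ _ coord_ring (subringClosedP _).
HB.instance Definition _ := [SubZmodule_isSubLmodule of coord_ring by <:].

Definition derivation (D : {linear coord_ring -> coord_ring}) : Prop :=
  forall f g, D (f * g) = D f * g + f * D g.

Definition locally_nilpotent (D : {linear coord_ring -> coord_ring}) : Prop :=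
  forall f, exists2 n, (0 < n)%N & iter n D f = 0.

Definition rigid : Prop :=
  forall D : {linear coord_ring -> coord_ring},
    derivation D -> locally_nilpotent D -> forall f, D f = 0.

End CoordinateRing.

(* An algebraic group acting faithfully on an affine variety is affine, so
   affine algebraic groups account for all algebraic subgroups of Aut X. *)
Record alg_group := AlgGroup {
  ag_var :> affvar;
  ag_one : ag_var;
  ag_inv : ag_var -> ag_var;
  ag_mul : ag_var -> ag_var -> ag_var;
  ag_mulA : associative ag_mul;
  ag_mul1 : left_id ag_one ag_mul;
  ag_mulV : left_inverse ag_one ag_inv ag_mul;
  ag_inv_regular : regular_map ag_inv;
  ag_mul_regular : regular_map2 ag_mul
}.

Section Automorphisms.
Variable X : affvar.

Definition Aut : set (X -> X) :=
  [set phi | regular_map phi /\ exists psi : X -> X,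
     [/\ regular_map psi, cancel phi psi & cancel psi phi]].

Definition subgroup_of_Aut (G : set (X -> X)) : Prop :=
  [/\ G `<=` Aut, G id,
      (forall phi psi, G phi -> G psi -> G (phi \o psi)) &
      (forall phi psi, G phi -> cancel phi psi -> cancel psi phi -> G psi)].

Definition faithful_regular_action (G : alg_group) (act : G -> X -> X) : Prop :=
  [/\ regular_map2 act, act (ag_one G) = id,
      (forall g h, act (ag_mul g h) = act g \o act h) & injective act].

Definition connected_algebraic_subgroup (H : set (X -> X)) : Prop :=
  subgroup_of_Aut H /\
  exists (G : alg_group) (act : G -> X -> X),
    [/\ zariski_connected G, faithful_regular_action act & H = range act].

Definition Aut_alg : set (X -> X) :=
  smallest subgroup_of_Aut
    (\bigcup_(H in [set H | connected_algebraic_subgroup H]) H).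

Definition Aut_alg_orbit (x : X) : set X := [set phi x | phi in Aut_alg].

End Automorphisms.

(* The coordinates T_{0j}, T_{1j}, T_{2j} occupy the first n0, the next n1 and
   the last n2 places; the first product is 1 when n0 = 0. *)
Definition trinomial n0 n1 n2
    (l0 : 'I_n0 -> nat) (l1 : 'I_n1 -> nat) (l2 : 'I_n2 -> nat) :
    {mpoly K[n0 + n1 + n2]} :=
  \prod_(j < n0) 'X_(lshift n2 (lshift n1 j)) ^+ l0 j
  + \prod_(j < n1) 'X_(lshift n2 (rshift n0 j)) ^+ l1 j
  + \prod_(j < n2) 'X_(rshift (n0 + n1) j) ^+ l2 j.

Definition trinomial_hypersurface n0 n1 n2
    (l0 : 'I_n0 -> nat) (l1 : 'I_n1 -> nat) (l2 : 'I_n2 -> nat) : affvar :=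
  AffVar [:: trinomial l0 l1 l2].

End AffineVarieties.

Arguments trinomial_hypersurface K {n0 n1 n2} l0 l1 l2.

(* Main.v *)
Require Import Defs.
From mathcomp Require Import all_boot all_order all_algebra.
From mathcomp Require Import separable ring.
From mathcomp Require Import mpoly.
From mathcomp Require Import boolp classical_sets functions cardinality.

(** Write the equation as mu_0 + mu_1 + mu_2 = 0, where mu_i is the monomial in
    the i-th block of coordinates. The diagonal matrices that multiply the three
    monomials by one common factor form a quasitorus acting on X.

    The quasitorus is contained in Aut_alg X up to finite index
    ([torus_decomposition]), because one-parameter groups of diagonal matrices
    are connected algebraic subgroups. Two points with the same vanishing
    coordinates lie in one orbit of the quasitorus as soon as their triples
    (mu_0, mu_1, mu_2) are proportional ([same_torus_orbit]); when some
    coordinate vanishes this is automatic, a triple with zero sum and a zero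
    entry being determined up to a factor. So the complement of the open set U,
    where all coordinates are non-zero, meets only finitely many orbits of
    Aut_alg X, and so does each part of U on which the ratio mu_0 / mu_1 is
    fixed. It remains to pass from one value of the ratio to another.

    That is what a non-zero locally nilpotent derivation D does. Its flow
    exp(tD) is an action of the additive group, so it lies in Aut_alg X. It
    cannot preserve the ratio mu_0 / mu_1 ([flow_moves_ratio]). Otherwise the
    flow would preserve mu_i = 0 at the points where the other two monomials are
    non-zero, and then, by density ([density], [density_all_zero]), it would
    preserve the complement of U; along an orbit starting in U each coordinate
    would be a nowhere vanishing polynomial in the time, hence constant, and D
    would vanish. Therefore some x in U has an orbit along which the ratio is a
    non-constant rational function of the time, which takes all but finitely
    many values ([quotient_values]). So the translates of the orbit of x by the
    quasitorus cover U except for finitely many values of the ratio, and since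
    Aut_alg X is normal in the group of automorphisms ([Aut_alg_conj]), finitely
    many orbits of Aut_alg X cover these translates. *)

Set Implicit Arguments.
Unset Strict Implicit.
Unset Printing Implicit Defensive.

Import GRing.Theory.
Local Open Scope ring_scope.
Local Open Scope classical_set_scope.

(** * Algebraic preliminaries *)

Section ClosedField.
Variable K : closedFieldType.

Lemma closed_field_avoid (s : seq K) : exists2 a, a != 0 & a \notin s.
Proof.
have [|a sa] := PreClosedField.closed_nonrootP (@solve_monicpoly K)
  (\prod_(z <- 0 :: s) ('X - z%:P)) _.
  by rewrite monic_neq0 ?monic_prod_XsubC.
exists a; move: sa; rewrite root_prod_XsubC inE; by case/norP.
Qed.

Lemma closed_field_root m a : (0 < m)%N -> exists z : K, z ^+ m = a.
Proof.
move=> m0; have [z zE] := @solve_monicpoly K m (fun i => if i == 0%N then a else 0) m0.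
exists z; rewrite zE; case: m m0 {zE} => // m _.
rewrite big_ord_recl /= expr0 mulr1 big1 ?addr0 // => i _.
by rewrite mul0r.
Qed.

Lemma meval_morph n (S : comNzRingType) (f : K -> S) (g : {rmorphism S -> K})
    (c : 'I_n -> S) p : cancel f g -> g (mmap f c p) = p.@[fun k => g (c k)].
Proof.
move=> fK; rewrite /meval /mmap rmorph_sum; apply: eq_bigr => m _.
rewrite rmorphM fK rmorph_prod; congr (_ * _).
by apply: eq_bigr => k _; rewrite rmorphXn.
Qed.

Lemma horner_mmap n (c : 'I_n -> {poly K}) p a :
  (mmap polyC c p).[a] = p.@[fun k => (c k).[a]].
Proof.
by apply: (@meval_morph n {poly K} polyC (horner_eval a)) => z; apply: hornerC.
Qed.

Hypothesis charK : [pchar K] =i pred0.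

Lemma natr_char0_neq0 n : (0 < n)%N -> n%:R != 0 :> K.
Proof. by move/(pcharf0P K): charK => ->; rewrite -lt0n. Qed.

Lemma fact_neq0 n : n`!%:R != 0 :> K.
Proof. exact/natr_char0_neq0/fact_gt0. Qed.

Lemma distinct_roots m (a : K) : (0 < m)%N -> a != 0 ->
  exists rs : seq K, [/\ uniq rs, size rs = m & forall s, s \in rs -> s ^+ m = a].
Proof.
move=> m0 a0; have [rs] := closed_field_poly_normal ('X^m - a%:P).
have mon : 'X^m - a%:P \is monic by apply: monicXnsubC.
rewrite (monicP mon) scale1r => rsE; exists rs; split.
- rewrite -separable_prod_XsubC -rsE.
  rewrite unlock; apply: Pdiv.ClosedField.root_coprimep => x.
  rewrite derivB derivXn derivC subr0 /root !hornerE subr_eq0.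
  move=> xm; apply: contraNneq a0; move/eqP: xm => <-.
  rewrite hornerMn hornerXn -mulr_natr => /eqP.
  rewrite mulf_eq0 (negbTE (natr_char0_neq0 m0)) orbF expf_eq0 => /andP[_ /eqP->].
  by rewrite expr0n; case: m m0 {mon rsE}.
- apply: succn_inj; rewrite -(size_prod_XsubC rs id) -rsE.
  by rewrite size_XnsubC.
- move=> s srs; apply/eqP; rewrite -subr_eq0.
  have : root ('X^m - a%:P) s by rewrite rsE root_prod_XsubC.
  by rewrite /root !hornerE.
Qed.

(** On the curve s^m = h(r), a polynomial G(r, s) vanishing at all but finitely
    many points vanishes at the branch points. Modulo s^m - h(r) it has degree
    less than m in s; over a general r there are m values of s, so its remainder
    is zero. *)
Lemma cyclic_cover_branch m (h : {poly K}) (G : {poly {poly K}}) :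
  (0 < m)%N -> h != 0 ->
  (forall r s, r != 0 -> s != 0 -> s ^+ m = h.[r] -> G.[s%:P].[r] = 0) ->
  forall r, h.[r] = 0 -> G.[0].[r] = 0.
Proof.
move=> m0 h0 GZ r hr; pose d : {poly {poly K}} := 'X^m - h%:P.
have mon : d \is monic by apply: monicXnsubC.
have GE := Pdiv.RingMonic.rdivp_eq mon G.
set Q := Pdiv.CommonRing.rdivp _ _ in GE.
set R := Pdiv.CommonRing.rmodp _ _ in GE.
have szR : (size R <= m)%N.
  rewrite -ltnS -(@size_XnsubC _ m h m0).
  exact: Pdiv.CommonRing.ltn_rmodpN0 (monic_neq0 mon).
suff R0 : R = 0.
  rewrite GE R0 addr0 hornerM /d hornerD hornerN hornerXn hornerC.
  by rewrite expr0n gtn_eqF //= sub0r mulrN hornerN hornerM hr mulr0 oppr0.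
apply/polyP => k; rewrite coef0; apply/eqP; apply: contraT => Rk0.
have [|r'] := PreClosedField.closed_nonrootP (@solve_monicpoly K)
  ('X * h * R`_k) _; first by rewrite !mulf_neq0 // polyX_eq0.
rewrite !rootM !negb_or /root hornerX => /andP[/andP[r0 hr0] /eqP[]].
have [rs [rsu rss rsE]] := distinct_roots m0 hr0.
have : map_poly (horner_eval r') R = 0.
  apply: (roots_geq_poly_eq0 (rs := rs)) => //; last first.
    by rewrite rss (leq_trans _ szR) // size_poly.
  apply/allP => s /rsE sE; have s0 : s != 0.
    by apply: contraNneq hr0 => s0; rewrite -sE s0 expr0n gtn_eqF.
  have -> : s = horner_eval r' s%:P by rewrite /horner_eval hornerC.
  rewrite /root horner_map /= /horner_eval -(GZ r' s) //.
  rewrite GE hornerD hornerD hornerM hornerM hornerD hornerN hornerXn !hornerC.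
  by rewrite hornerD hornerN horner_exp hornerC sE subrr mulr0 add0r.
by move=> /polyP/(_ k); rewrite coef_map coef0 /= /horner_eval.
Qed.

End ClosedField.

(** Divide p and q by their greatest common divisor g. Then p - c q is
    non-constant for all c but one, and q does not vanish at its roots. The
    values of the quotient at the roots of g are excluded too, since there the
    original p and q vanish together. *)
Lemma quotient_values (K : closedFieldType) (p q : {poly K}) t0 t1 :
  p.[t1] * q.[t0] != p.[t0] * q.[t1] ->
  exists bad : seq K, forall c, c \notin bad ->
    exists t, q.[t] != 0 /\ p.[t] = c * q.[t].
Proof.
move=> npr; pose g := gcdp p q; pose p' : {poly K} := p %/ g; pose q' : {poly K} := q %/ g.
have pq0 : (p != 0) || (q != 0).
  rewrite -negb_and; apply: contra npr => /andP[/eqP-> /eqP->].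
  by rewrite !horner0 mul0r.
have g0 : g != 0 by rewrite gcdp_eq0 negb_and.
have pE : p = p' * g by rewrite divpK // dvdp_gcdl.
have qE : q = q' * g by rewrite divpK // dvdp_gcdr.
have cop : coprimep p' q' by apply: coprimep_div_gcd.
have [c0 c0P] : exists c0 : K, forall c, c != c0 -> (1 < size (p' - c *: q')%R)%N.
  case: (pselect (exists c0 : K, (size (p' - c0 *: q')%R <= 1)%N)) => [[c0 s0]|h].
    exists c0 => c cc0; rewrite ltnNge; apply: contra npr => s.
    (* two constant members of the pencil make p' and q' constant *)
    have q1 : (size q' <= 1)%N.
      have -> : q' = (c - c0)^-1 *: ((p' - c0 *: q') - (p' - c *: q')).
        rewrite opprD opprK addrACA subrr add0r addrC -scalerBl scalerA.
        by rewrite mulVf ?scale1r // subr_eq0.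
      apply: leq_trans (size_scale_leq _ _) _.
      apply: leq_trans (size_polyD _ _) _.
      by rewrite size_polyN geq_max s0 s.
    have p1 : (size p' <= 1)%N.
      have -> : p' = (p' - c *: q') + c *: q' by rewrite subrK.
      apply: leq_trans (size_polyD _ _) _; rewrite geq_max s.
      exact: leq_trans (size_scale_leq _ _) q1.
    rewrite pE qE (size1_polyC p1) (size1_polyC q1) !hornerM !hornerC.
    by apply/eqP; ring.
  exists 0 => c _; rewrite ltnNge; apply/negP => s; apply: h.
  by exists c.
have [rs rsE] := closed_field_poly_normal g.
exists (c0 :: [seq p'.[t] / q'.[t] | t <- rs]) => c.
rewrite inE negb_or => /andP[cc0 cbad].
have := c0P c cc0; rewrite ltn_neqAle eq_sym => /andP[/closed_rootP[t] + _].
rewrite /root hornerD hornerN hornerZ subr_eq0 => /eqP pt.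
have qt : q'.[t] != 0.
  apply: contraTneq isT => qt; have := coprimep_root cop.
  by move=> /(_ t); rewrite /root pt qt mulr0 eqxx => /(_ isT).
have gt : g.[t] != 0.
  apply: contra cbad => gt; apply/mapP; exists t.
    have : root g t by [].
    by rewrite rsE rootZ ?lead_coef_eq0 // root_prod_XsubC.
  by rewrite pt mulfK.
exists t; rewrite pE qE !hornerM mulf_neq0 // pt.
by rewrite mulrA.
Qed.

Lemma int_gcd_family n (w : 'I_n -> int) : exists g (u w' : 'I_n -> int),
  (forall k, w k = w' k * g) /\ g = \sum_k u k * w k.
Proof.
suff [g [u [gw gE]]] : exists g (u : 'I_n -> int),
    (forall k, (g %| w k)%Z) /\ g = \sum_k u k * w k.
  exists g, u, (fun k => (w k %/ g)%Z); split=> // k.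
  by rewrite divzK.
suff [g [u [gw gE]]] : exists g (u : 'I_n -> int),
    (forall k, k \in enum 'I_n -> (g %| w k)%Z) /\ g = \sum_k u k * w k.
  by exists g, u; split=> // k; apply: gw; rewrite mem_enum.
elim: (enum 'I_n) => [|k r [g [u [gw gE]]]].
  by exists 0, (fun=> 0); split=> //; rewrite big1 // => k _; rewrite mul0r.
have [a [b abE]] := Bezoutz (w k) g.
exists (gcdz (w k) g), (fun j => b * u j + (if j == k then a else 0)).
split=> [j|].
  rewrite inE => /orP[/eqP->|/gw gj]; first exact: dvdz_gcdl.
  exact: dvdz_trans (dvdz_gcdr _ _) gj.
rewrite -abE [in LHS]gE mulr_sumr (eq_bigr _ (fun _ _ => mulrDl _ _ _)).
rewrite big_split addrC /=; congr (_ + _).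
  by apply: eq_bigr => j _; rewrite mulrA.
rewrite (bigD1 k) //= eqxx big1 ?addr0 // => j /negbTE->.
by rewrite mul0r.
Qed.


(** * Regular actions and connected algebraic subgroups *)

Section Points.
Variable K : closedFieldType.

Lemma concat_l m n (x : 'I_m -> K) (y : 'I_n -> K) i :
  concat x y (lshift n i) = x i.
Proof. by rewrite /concat (unsplitK (inl i)). Qed.

Lemma concat_r m n (x : 'I_m -> K) (y : 'I_n -> K) i :
  concat x y (rshift m i) = y i.
Proof. by rewrite /concat (unsplitK (inr i)). Qed.

Lemma apoint_eq (X : affvar K) (x y : X) :
  (forall k, val x k = val y k) -> x = y.
Proof. by move=> e; apply/val_inj/ffunP. Qed.

Lemma vanish_point (X : affvar K) (x : X) p : p \in aeqs X -> p.@[val x] = 0.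
Proof. by move=> pX; apply/eqP; have /allP := valP x; apply. Qed.

Lemma regular_map_comp (X : affvar K) (phi psi : X -> X) :
  regular_map phi -> regular_map psi -> regular_map (phi \o psi).
Proof.
move=> rphi rpsi k; have [p pE] := rphi k.
pose P := fun j => projT1 (cid (rpsi j)).
have PE j x : val (psi x) j = (P j).@[val x] := projT2 (cid (rpsi j)) x.
exists (p \mPo [tuple P j | j < adim X]) => x.
rewrite comp_mpoly_meval /= pE; apply: meval_eq => j.
by rewrite tnth_mktuple PE.
Qed.

Lemma Aut_subgroup (X : affvar K) : subgroup_of_Aut (@Aut K X).
Proof.
split=> //.
- split; last by exists id; split=> // k; exists 'X_k => x; rewrite mevalXU.
  by move=> k; exists 'X_k => x; rewrite mevalXU.
- move=> phi psi [rphi [phi' [rphi' k1 k2]]] [rpsi [psi' [rpsi' k3 k4]]].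
  split; first exact: regular_map_comp.
  exists (psi' \o phi'); split; first exact: regular_map_comp.
    exact: can_comp.
  exact: can_comp.
- move=> phi psi [rphi [phi' [rphi' k1 k2]]] k3 k4.
  have -> : psi = phi' by apply/funext => x; rewrite -{1}(k2 x) k3.
  by split=> //; exists phi; split.
Qed.

Lemma Aut_alg_subgroup (X : affvar K) : subgroup_of_Aut (@Aut_alg K X).
Proof.
split.
- apply: smallest_sub; first exact: Aut_subgroup.
  by move=> phi [H [[HA _ _ _] _] Hphi]; apply: HA.
- by move=> G [[_ G1 _ _] _].
- move=> phi psi gphi gpsi G [sG GG]; have [_ _ Gc _] := sG.
  by apply: Gc; [apply: gphi|apply: gpsi].
- move=> phi psi gphi k1 k2 G [sG GG]; have [_ _ _ Gi] := sG.
  by apply: Gi k1 k2; apply: gphi.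
Qed.

Lemma in_Aut_alg (X : affvar K) (H : set (X -> X)) phi :
  connected_algebraic_subgroup H -> H phi -> Aut_alg phi.
Proof.
by move=> cH Hphi; apply: (sub_gen_smallest (G := _)); exists H.
Qed.

Lemma Aut_alg_orbit_eq (X : affvar K) (phi : X -> X) (x : X) :
  Aut_alg phi -> Aut_alg_orbit (phi x) = Aut_alg_orbit x.
Proof.
move=> gphi; have [sA _ Ac Ai] := Aut_alg_subgroup X.
have [_ [psi [_ k1 k2]]] := sA _ gphi.
apply/seteqP; split=> [_ [chi gchi <-]|_ [chi gchi <-]].
  by exists (chi \o phi) => //; apply: Ac.
exists (chi \o psi); last by rewrite /= k1.
by apply: Ac => //; apply: Ai k1 k2.
Qed.

Lemma regular_map2_left (X Y Z : affvar K) (f : X -> Y -> Z) g :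
  regular_map2 f -> regular_map (f g).
Proof.
move=> fr k; have [p pE] := fr k.
exists (p \mPo [tuple match fintype.split j with
               | inl i => (val g i)%:MP | inr i => 'X_i end
               | j < adim X + adim Y]) => x.
rewrite pE comp_mpoly_meval; apply: meval_eq => j.
rewrite tnth_mktuple /concat; case: (fintype.split j) => i.
  by rewrite mevalC.
by rewrite mevalXU.
Qed.

Section Action.
Variables (X : affvar K) (G : alg_group K) (act : G -> X -> X).
Hypothesis actP : faithful_regular_action act.

Lemma action_inv g : cancel (act g) (act (ag_inv g)) /\
                     cancel (act (ag_inv g)) (act g).
Proof.
case: actP => _ a1 aM _.
have kV h : cancel (act h) (act (ag_inv h)).
  by move=> x; have := aM (ag_inv h) h; rewrite ag_mulV a1 => /(congr1 (@^~ x)).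
split=> // x; have e := kV (ag_inv g) (act g (act (ag_inv g) x)).
by rewrite (kV g) in e; rewrite -e; apply: (kV (ag_inv g)).
Qed.

Lemma range_connected_subgroup :
  zariski_connected G -> connected_algebraic_subgroup (range act).
Proof.
move=> cG; split; last by exists G, act.
case: (actP) => ar a1 aM _; split.
- move=> _ [g _ <-]; split; first exact: regular_map2_left.
  exists (act (ag_inv g)); have [] := action_inv g.
  by split=> //; apply: regular_map2_left.
- by exists (ag_one G).
- by move=> _ _ [g _ <-] [h _ <-]; exists (ag_mul g h).
- move=> _ psi [g _ <-] k1 k2; exists (ag_inv g) => //.
  by apply/funext => x; rewrite -{1}(k2 x) (action_inv g).1.
Qed.

Lemma conj_action (psi psi' : X -> X) :
  regular_map psi -> regular_map psi' -> cancel psi psi' -> cancel psi' psi ->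
  faithful_regular_action (fun g => psi \o act g \o psi').
Proof.
move=> rpsi rpsi' k1 k2; case: actP => ar a1 aM ai; split.
- move=> k; have [q qE] := rpsi k.
  pose P := fun j => projT1 (cid (ar j)).
  have PE j g x : val (act g x) j = (P j).@[concat (val g) (val x)]
    := projT2 (cid (ar j)) g x.
  pose Q := fun j => projT1 (cid (rpsi' j)).
  have QE j x : val (psi' x) j = (Q j).@[val x] := projT2 (cid (rpsi' j)) x.
  pose S := [tuple match fintype.split j with
      | inl i => 'X_(lshift (adim X) i)
      | inr i => Q i \mPo [tuple 'X_(rshift (adim G) i') | i' < adim X]
      end : {mpoly K[adim G + adim X]} | j < adim G + adim X].
  exists (q \mPo [tuple P j \mPo S | j < adim X]) => g x /=.
  rewrite qE comp_mpoly_meval; apply: meval_eq => j.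
  rewrite tnth_mktuple PE comp_mpoly_meval; apply: meval_eq => i.
  rewrite tnth_mktuple {1}/concat; case: (fintype.split i) => i'.
    by rewrite mevalXU concat_l.
  rewrite QE comp_mpoly_meval; apply: meval_eq => i''.
  by rewrite tnth_mktuple mevalXU concat_r.
- by rewrite a1; apply/funext => x /=.
- by move=> g h; rewrite aM; apply/funext => x /=; rewrite k1.
- move=> g h e; apply: ai; apply/funext => x.
  have /(congr1 (fun f => psi' (f (psi x)))) := e.
  by rewrite /= !k1.
Qed.

End Action.

(** Aut_alg is normal in Aut: conjugation by an automorphism permutes the
    connected algebraic subgroups. *)
Lemma Aut_alg_conj (X : affvar K) (g g' phi : X -> X) :
  regular_map g -> regular_map g' -> cancel g g' -> cancel g' g ->
  Aut_alg phi -> Aut_alg (g \o phi \o g').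
Proof.
move=> rg rg' k1 k2; have [sA sid Ac Ai] := Aut_alg_subgroup X.
have [_ Aid Autc Auti] := Aut_subgroup X.
suff : @Aut_alg K X `<=` [set psi | Aut psi /\ Aut_alg (g \o psi \o g')].
  by move=> h /h[].
apply: smallest_sub.
  split=> [psi []|| psi chi [pA pG] [cA cG]|psi chi [pA pG] k3 k4] //.
  - split=> //; have -> : g \o id \o g' = id by apply/funext => x /=.
    exact: sid.
  - split; first exact: Autc.
    have -> : g \o (psi \o chi) \o g' = (g \o psi \o g') \o (g \o chi \o g').
      by apply/funext => x /=; rewrite k1.
    exact: Ac.
  - split; first exact: Auti pA k3 k4.
    by apply: Ai pG _ _ => x /=; rewrite k1 ?k3 ?k4 k2.
move=> psi [H [sH [G [act [cG actP HE]]]] Hpsi].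
split; first by have [HA _ _ _] := sH; apply: HA.
apply: (in_Aut_alg (range_connected_subgroup (conj_action actP rg rg' k1 k2) cG)).
by move: Hpsi; rewrite HE => -[a _ <-]; exists a.
Qed.

(** A variety swept out by a cofinite subset of the line, along a
    parametrisation pulling polynomials back to polynomials up to nowhere
    vanishing factors, is connected: a polynomial with infinitely many zeros
    is zero. *)
Lemma rational_curve_connected (X : affvar K) (U : pred K) (gam : K -> X) :
  (forall s : seq K, exists2 a, U a & a \notin s) ->
  (forall x, exists2 a, U a & x = gam a) ->
  (forall p, exists q : {poly K},
     forall a, U a -> (p.@[val (gam a)] == 0) = (q.[a] == 0)) ->
  zariski_connected X.
Proof.
move=> Uinf surj pull s t cov dis.
case: (pselect (forall x : X, vanish s (val x))) => [|/existsNP[x0]]; first by left.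
move=> /negP/allPn/=[p ps px0]; right=> x; apply/allP => r rt.
have [q qE] := pull p; have [u uE] := pull r.
have q0 : q != 0.
  apply: contraNneq px0 => q0; have [a Ua ->] := surj x0.
  by rewrite qE // q0 horner0.
suff u0 : u = 0 by have [a Ua ->] := surj x; rewrite uE // u0 horner0.
have [rs rsE] := closed_field_poly_normal (q * u).
apply/eqP; apply: contraT => un0.
have [a Ua ars] := Uinf rs.
have qu0 : (q * u).[a] != 0.
  rewrite rsE hornerZ mulf_neq0 // ?lead_coef_eq0 ?mulf_neq0 //.
  by rewrite -/(root _ a) root_prod_XsubC.
have /orP[/allP/(_ p ps)|/allP/(_ r rt)] := cov (gam a).
  by rewrite qE // hornerM in qu0 * => /eqP e; rewrite e mul0r eqxx in qu0.
by rewrite uE // hornerM in qu0 * => /eqP e; rewrite e mulr0 eqxx in qu0.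
Qed.

End Points.

(** * The additive group *)

Section AdditiveGroup.
Variable K : closedFieldType.
Hypothesis charK : [pchar K] =i pred0.

Definition ga_var : affvar K := @AffVar K 1 [::].

Lemma ga_vanish (x : {ffun 'I_1 -> K}) : vanish (aeqs ga_var) x.
Proof. by []. Qed.

Definition ga_pt (a : K) : ga_var :=
  exist _ [ffun _ => a] (ga_vanish [ffun _ => a]).

Definition ga_val (x : ga_var) : K := val x ord0.

Lemma ga_ptK : cancel ga_pt ga_val.
Proof. by move=> a; rewrite /ga_val /= ffunE. Qed.

Lemma ga_valK : cancel ga_val ga_pt.
Proof. by move=> x; apply: apoint_eq => k; rewrite ffunE ord1. Qed.

Definition ga_mul (x y : ga_var) := ga_pt (ga_val x + ga_val y).
Definition ga_inv (x : ga_var) := ga_pt (- ga_val x).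

Lemma ga_mulA : associative ga_mul.
Proof. by move=> x y z; rewrite /ga_mul !ga_ptK addrA. Qed.

Lemma ga_mul1 : left_id (ga_pt 0) ga_mul.
Proof. by move=> x; rewrite /ga_mul !ga_ptK add0r ga_valK. Qed.

Lemma ga_mulV : left_inverse (ga_pt 0) ga_inv ga_mul.
Proof. by move=> x; rewrite /ga_mul !ga_ptK addNr. Qed.

Lemma ga_inv_regular : regular_map ga_inv.
Proof.
by move=> k; exists (- 'X_ord0) => x; rewrite mevalN mevalXU /= ffunE.
Qed.

Lemma ga_mul_regular : regular_map2 ga_mul.
Proof.
move=> k; exists ('X_(lshift 1 ord0) + 'X_(rshift 1 ord0)) => x y.
by rewrite mevalD !mevalXU concat_l concat_r /= ffunE.
Qed.

Definition ga : alg_group K :=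
  AlgGroup ga_mulA ga_mul1 ga_mulV ga_inv_regular ga_mul_regular.

Lemma ga_connected : zariski_connected ga.
Proof.
apply: (@rational_curve_connected K ga predT ga_pt).
- by move=> s; have [a _ sa] := closed_field_avoid s; exists a.
- by move=> x; exists (ga_val x); rewrite ?ga_valK.
- move=> p; exists (mmap polyC (fun=> 'X) p) => a _.
  rewrite horner_mmap; congr (_ == 0); apply: meval_eq => k.
  by rewrite ffunE hornerX.
Qed.


(** * The flow of a locally nilpotent derivation *)

Section Flow.
Variable X : affvar K.

Lemma restr_regular (p : {mpoly K[adim X]}) :
  ((fun x : X => p.@[val x]) : X -> K^o) \in @regular_pred K X.
Proof. by apply/asboolP; exists p. Qed.

Definition restr p : coord_ring X := RegFun (restr_regular p).

Lemma coord_ring_eq (f g : coord_ring X) :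
  (forall x, regfun f x = regfun g x) -> f = g.
Proof. by move=> e; apply/val_inj/funext. Qed.

Lemma coord_ring_poly (f : coord_ring X) : exists p, f = restr p.
Proof.
case: f => f fr; have /asboolP[p pE] := fr.
by exists p; apply: coord_ring_eq.
Qed.

Variable D : {linear coord_ring X -> coord_ring X}.
Hypotheses (derD : derivation D) (nilD : locally_nilpotent D).

Lemma derivation1 : D 1 = 0.
Proof.
have := derD 1 1; rewrite !mul1r mulr1 => e.
by apply: (addrI (D 1)); rewrite addr0 -e.
Qed.

Lemma iter_der0 i : iter i D 0 = 0.
Proof. by elim: i => //= i ->; rewrite raddf0. Qed.

Lemma iter_derD i f g : iter i D (f + g) = iter i D f + iter i D g.
Proof. by elim: i => //= i ->; rewrite raddfD. Qed.

Lemma iter_derZ i c f : iter i D (c *: f) = c *: iter i D f.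
Proof. by elim: i => //= i ->; rewrite linearZ. Qed.

Lemma leibniz n f g : iter n D (f * g) =
  \sum_(i < n.+1) (iter i D f * iter (n - i) D g) *+ 'C(n, i).
Proof.
elim: n => [|n IH]; first by rewrite big_ord1.
rewrite iterS IH raddf_sum /=.
rewrite (eq_bigr (fun i : 'I_n.+1 =>
  (iter i.+1 D f * iter (n - i) D g) *+ 'C(n, i) +
  (iter i D f * iter (n - i).+1 D g) *+ 'C(n, i))); last first.
  by move=> i _; rewrite raddfMn /= derD mulrnDl.
rewrite big_split /= [RHS]big_ord_recl /= bin0.
rewrite [X in _ = _ + X](eq_bigr (fun i : 'I_n.+1 =>
   (iter i.+1 D f * iter (n - i) D g) *+ 'C(n, i.+1) +
   (iter i.+1 D f * iter (n - i) D g) *+ 'C(n, i))); last first.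
  by move=> i _; rewrite /bump /= add1n subSS binS mulrnDr.
rewrite big_split /= [RHS]addrA [RHS]addrC; congr (_ + _).
rewrite [in RHS]big_ord_recr /= bin_small // mulr0n addr0.
rewrite big_ord_recl /= bin0 subn0; congr (_ + _).
by apply: eq_bigr => i _; rewrite /= /bump leq0n add1n -(iterS (n - _)) -subSn.
Qed.

Definition nil_index f := projT1 (cid2 (nilD f)).

Lemma iter_der_eq0 f i : (nil_index f <= i)%N -> iter i D f = 0.
Proof.
rewrite /nil_index; case: (cid2 _) => n /= _ e /subnK <-.
by rewrite iterD e iter_der0.
Qed.

(** exp(TD) applied to f and evaluated at the point x, as a polynomial in the
    time T. *)
Definition expo f (x : X) : {poly K} :=
  \poly_(i < nil_index f) (regfun (iter i D f) x / i`!%:R).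

Lemma coef_expo f x i : (expo f x)`_i = regfun (iter i D f) x / i`!%:R.
Proof.
rewrite coef_poly; case: ltnP => // /iter_der_eq0 ->.
by rewrite /= mul0r.
Qed.

Lemma expoD f g x : expo (f + g) x = expo f x + expo g x.
Proof.
apply/polyP => i; rewrite coefD !coef_expo -mulrDl iter_derD.
by [].
Qed.

Lemma expoZ c f x : expo (c *: f) x = c%:P * expo f x.
Proof. by apply/polyP => i; rewrite coefCM !coef_expo mulrA iter_derZ. Qed.

Lemma expo0 x : expo 0 x = 0.
Proof.
by apply/polyP => i; rewrite coef0 coef_expo iter_der0 mul0r.
Qed.

Lemma expo1 x : expo 1 x = 1.
Proof.
apply/polyP => -[|i]; rewrite coef1 coef_expo /= ?divr1 //.
by rewrite -iterS iterSr derivation1 iter_der0 mul0r.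
Qed.

Lemma regfun_sum (I : Type) (s : seq I) (F : I -> coord_ring X) x :
  regfun (\sum_(i <- s) F i) x = \sum_(i <- s) regfun (F i) x.
Proof.
elim: s => [|i s IH]; first by rewrite !big_nil.
by rewrite !big_cons -IH.
Qed.

Lemma regfun_prod (I : Type) (s : seq I) (F : I -> coord_ring X) x :
  regfun (\prod_(i <- s) F i) x = \prod_(i <- s) (regfun (F i) x : K).
Proof.
elim: s => [|i s IH]; first by rewrite !big_nil.
by rewrite !big_cons -IH.
Qed.

Lemma regfunX (f : coord_ring X) n x :
  regfun (f ^+ n) x = (regfun f x : K) ^+ n.
Proof. by elim: n => // n IH; rewrite !exprS -IH. Qed.

Lemma regfunMn (f : coord_ring X) n x : regfun (f *+ n) x = regfun f x *+ n.
Proof. by elim: n => // n IH; rewrite !mulrS -IH. Qed.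

Lemma expoM f g x : expo (f * g) x = expo f x * expo g x.
Proof.
apply/polyP => n; rewrite coefM coef_expo leibniz regfun_sum mulr_suml.
apply: eq_bigr => i _; rewrite !coef_expo regfunMn.
have le_in : (i <= n)%N by rewrite -ltnS.
have b0 : 'C(n, i)%:R != 0 :> K by apply: (natr_char0_neq0 charK); rewrite bin_gt0.
transitivity ((regfun (iter i D f) x : K) * regfun (iter (n - i) D g) x
              * 'C(n, i)%:R / n`!%:R); first by rewrite mulr_natr.
rewrite -[in LHS](bin_fact le_in) natrM [(i`! * _)%:R]natrM.
by rewrite mulf_div invfM [LHS]mulrA mulfK.
Qed.

Lemma expo_prod (I : Type) (s : seq I) (F : I -> coord_ring X) x :
  expo (\prod_(i <- s) F i) x = \prod_(i <- s) expo (F i) x.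
Proof. exact: (big_morph _ (fun f g => expoM f g x) (expo1 x)). Qed.

Lemma expoX f n x : expo (f ^+ n) x = expo f x ^+ n.
Proof. by elim: n => [|n IH]; rewrite ?expo1 // !exprS expoM IH. Qed.

Lemma expo_restr p x :
  expo (restr p) x = mmap polyC (fun k => expo (restr 'X_k) x) p.
Proof.
elim/mpolyind: p => [|c m p _ _ IH].
  rewrite mmap0 (_ : restr 0 = 0) ?expo0 //.
  by apply: coord_ring_eq => y /=; rewrite meval0.
rewrite mmapD mmapZ -IH mmapX.
rewrite (_ : restr _ = c *: (\prod_k restr 'X_k ^+ m k) + restr p); last first.
  apply: coord_ring_eq => y /=; rewrite mevalD mevalZ mevalX.
  rewrite [RHS]/(c * regfun (\prod_k restr 'X_k ^+ m k) y + p.@[val y]).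
  rewrite regfun_prod; congr (_ * _ + _).
  by apply: eq_bigr => k _; rewrite regfunX /= mevalXU.
rewrite expoD expoZ expo_prod; congr (_ * _ + _).
by apply: eq_bigr => k _; rewrite expoX.
Qed.


(** The map f |-> expo f x is a ring homomorphism, hence commutes with the
    evaluation of polynomials; so it maps the equations of X to equations
    satisfied by the moved coordinates. *)
Lemma flow_vanish t (x : X) :
  vanish (aeqs X) [ffun k => (expo (restr 'X_k) x).[t]].
Proof.
apply/allP => p pX; apply/eqP.
transitivity (expo (restr p) x).[t].
  rewrite expo_restr horner_mmap; apply: meval_eq => k.
  by rewrite ffunE.
rewrite (_ : restr p = 0) ?expo0 ?horner0 //.
by apply: coord_ring_eq => y /=; rewrite vanish_point.
Qed.

Definition flow (t : K) (x : X) : X := 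
  exist (fun y : {ffun 'I_(adim X) -> K} => is_true (vanish (aeqs X) y))
    _ (flow_vanish t x).

Lemma regfun_flow f t x : regfun f (flow t x) = (expo f x).[t].
Proof.
have [p ->] := coord_ring_poly f.
rewrite expo_restr horner_mmap; apply: meval_eq => k.
by rewrite ffunE.
Qed.

Lemma flow0 : flow 0 = id.
Proof.
apply/funext => x; apply: apoint_eq => k.
by rewrite ffunE horner_coef0 coef_expo /= divr1 mevalXU.
Qed.

Lemma expo_iter_der i f x : expo (iter i D f) x = i`!%:R *: (expo f x)^`N(i).
Proof.
apply/polyP => j; rewrite coefZ coef_nderivn !coef_expo -iterD addnC.
rewrite -[in RHS](bin_fact (leq_addr j i)) addKn natrM [(i`! * _)%:R]natrM.
have b0 : 'C(i + j, i)%:R != 0 :> K.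
  by apply: (natr_char0_neq0 charK); rewrite bin_gt0 leq_addr.
rewrite -mulr_natr; field.
by rewrite b0 !(fact_neq0 charK).
Qed.

(** The Taylor expansion of exp((t + s)D) f at the time t. *)
Lemma flowD s t : flow (s + t) = flow s \o flow t.
Proof.
apply/funext => x; apply: apoint_eq => k.
rewrite /= !ffunE addrC.
set f := restr 'X_k.
have sz y : (size (expo f y) <= nil_index f)%N by apply: size_poly.
rewrite (nderiv_taylor_wide (n := nil_index f)) //; last exact: mulrC.
rewrite (horner_coef_wide _ (sz _)); apply: eq_bigr => i _.
rewrite coef_expo regfun_flow expo_iter_der hornerZ.
by rewrite [i`!%:R * _]mulrC mulfK ?(fact_neq0 charK).
Qed.

Lemma flowK t : cancel (flow t) (flow (- t)).
Proof. by move=> x; rewrite -[LHS]/((flow _ \o flow _) x) -flowD addNr flow0. Qed.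

(** Any element of the kernel of D^2 outside the kernel of D is such a function:
    the flow acts on it by translations. *)
Lemma local_slice : ~ (forall f, D f = 0) ->
  exists f, D f <> 0 /\
    forall x t, regfun f (flow t x) = regfun f x + t * regfun (D f) x.
Proof.
move=> /existsNP[g Dg0].
have exn : exists n, `[< iter n D g = 0 >].
  by have [n _ e] := nilD g; exists n; apply/asboolP.
case: (ex_minnP exn) => -[|[|n]] /asboolP e nmin.
- by case: Dg0; rewrite [g]e raddf0.
- by case: Dg0.
pose f := iter n D g.
have Df0 : ~ (D f = 0).
  by move=> Df0; have := nmin n.+1; rewrite ltnn => /(_ (introT (asboolP _) Df0)).
exists f; split=> // x t.
have -> : regfun f x + t * regfun (D f) x =
  ((regfun f x)%:P + (regfun (D f) x)%:P * 'X).[t] by rewrite !hornerE mulrC.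
rewrite regfun_flow; congr _.[t]; apply/polyP => i.
rewrite coefD coefC coefCM coefX coef_expo; case: i => [|[|i]].
- by rewrite mulr0 addr0 divr1.
- by rewrite mulr1 add0r divr1.
by rewrite mulr0 addr0 -addn2 iterD -(iterD 2) e iter_der0 mul0r.
Qed.

Definition ga_act (a : ga) : X -> X := flow (ga_val a).

Lemma ga_act_regular : regular_map2 ga_act.
Proof.
move=> k; set f := restr 'X_k.
have Pex i : exists p, iter i D f = restr p by apply: coord_ring_poly.
pose P i := projT1 (cid (Pex i)).
have PE i : iter i D f = restr (P i) := projT2 (cid (Pex i)).
exists (\sum_(i < nil_index f) (i`!%:R)^-1 *:
   ((P i \mPo [tuple 'X_(rshift 1 j) | j < adim X]) *
    'X_(lshift (adim X) ord0) ^+ i)) => a x.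
rewrite /= ffunE horner_poly raddf_sum /=; apply: eq_bigr => i _.
rewrite mevalZ mevalM -/f PE /= mulrA [_^-1 * _]mulrC.
rewrite comp_mpoly_meval rmorphXn /= mevalXU concat_l; congr (_ / _ * _).
by apply: meval_eq => j; rewrite tnth_mktuple mevalXU concat_r.
Qed.

Lemma ga_act_faithful : ~ (forall f, D f = 0) -> faithful_regular_action ga_act.
Proof.
move=> D0; split.
- exact: ga_act_regular.
- by rewrite /ga_act ga_ptK flow0.
- by move=> a b; rewrite /ga_act ga_ptK flowD.
move=> a b; rewrite /ga_act => e.
have [f [Df0 fE]] := local_slice D0.
have [x /eqP fx] : exists x, regfun (D f) x <> 0.
  by apply/existsNP => h; apply: Df0; apply: coord_ring_eq.
rewrite -[a]ga_valK -[b]ga_valK; congr ga_pt; apply: (mulIf fx).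
by apply: (addrI (regfun f x)); rewrite -!fE e.
Qed.

End Flow.
End AdditiveGroup.

(** * The multiplicative group and one-parameter groups of scalings *)

Section MultiplicativeGroup.
Variable K : closedFieldType.
Implicit Types s t a : K.

Definition gm_var : affvar K := @AffVar K 2 [:: 'X_ord0 * 'X_ord_max - 1].

Definition gm_coord s : {ffun 'I_2 -> K} :=
  [ffun k => if k == ord0 then s else s^-1].

Lemma gm_vanish s : s != 0 -> vanish (aeqs gm_var) (gm_coord s).
Proof.
move=> s0; rewrite /vanish /= andbT mevalB mevalM !mevalXU meval1 !ffunE /=.
by rewrite divff // subrr.
Qed.

Definition gm_one : gm_var :=
  exist (fun y : {ffun 'I_2 -> K} => is_true (vanish (aeqs gm_var) y))
    (gm_coord 1) (gm_vanish (oner_neq0 _)).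

Definition gm_pt s : gm_var := insubd gm_one (gm_coord s).

Definition gm_val (x : gm_var) : K := val x ord0.

Lemma gm_coord_pt s : s != 0 -> val (gm_pt s) = gm_coord s.
Proof. by move=> s0; rewrite val_insubd gm_vanish. Qed.

Lemma gm_ptK s : s != 0 -> gm_val (gm_pt s) = s.
Proof. by move=> s0; rewrite /gm_val gm_coord_pt // ffunE. Qed.

Lemma gm_val_mul (x : gm_var) : val x ord0 * val x ord_max = 1.
Proof.
apply/eqP; rewrite -subr_eq0; apply/eqP.
have := vanish_point x (mem_head _ _).
by rewrite mevalB mevalM !mevalXU meval1.
Qed.

Lemma gm_val_neq0 x : gm_val x != 0.
Proof.
apply: contra_eq_neq (gm_val_mul x) => /= x0.
by rewrite -/(gm_val x) x0 mul0r eq_sym oner_neq0.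
Qed.

Lemma gm_val_inv (x : gm_var) : val x ord_max = (gm_val x)^-1.
Proof.
apply: (mulfI (gm_val_neq0 x)).
by rewrite divff ?gm_val_neq0 // gm_val_mul.
Qed.

Lemma gm_valK : cancel gm_val gm_pt.
Proof.
move=> x; apply: apoint_eq => k; rewrite gm_coord_pt ?gm_val_neq0 // ffunE.
have [->|] := eqVneq k ord0; first by [].
case: k => -[|[|m]] // k2 _.
by rewrite -gm_val_inv; congr (val x _); apply: val_inj.
Qed.

Definition gm_mul x y := gm_pt (gm_val x * gm_val y).
Definition gm_inv x := gm_pt (gm_val x)^-1.

Lemma gm_mulA : associative gm_mul.
Proof.
by move=> x y z; rewrite /gm_mul !gm_ptK ?mulf_neq0 ?gm_val_neq0 // mulrA.
Qed.

Lemma gm_mul1 : left_id (gm_pt 1) gm_mul.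
Proof. by move=> x; rewrite /gm_mul gm_ptK ?oner_neq0 // mul1r gm_valK. Qed.

Lemma gm_mulV : left_inverse (gm_pt 1) gm_inv gm_mul.
Proof.
move=> x; rewrite /gm_mul gm_ptK ?invr_neq0 ?gm_val_neq0 //.
by rewrite mulVf ?gm_val_neq0.
Qed.

Lemma gm_inv_regular : regular_map gm_inv.
Proof.
move=> k; exists (if k == ord0 then 'X_ord_max else 'X_ord0) => x.
rewrite gm_coord_pt ?invr_neq0 ?gm_val_neq0 // ffunE invrK.
by case: ifP => _; rewrite mevalXU ?gm_val_inv.
Qed.

Lemma gm_mul_regular : regular_map2 gm_mul.
Proof.
move=> k; exists ('X_(lshift 2 k) * 'X_(rshift 2 k)) => x y.
rewrite mevalM !mevalXU concat_l concat_r.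
rewrite gm_coord_pt ?mulf_neq0 ?gm_val_neq0 // ffunE.
have [->|] := eqVneq k ord0; first by [].
case: k => -[|[|m]] // k2 _.
have -> : Ordinal k2 = ord_max by apply: val_inj.
by rewrite !gm_val_inv invfM.
Qed.

Definition gm : alg_group K :=
  AlgGroup gm_mulA gm_mul1 gm_mulV gm_inv_regular gm_mul_regular.

Lemma gm_connected : zariski_connected gm.
Proof.
apply: (@rational_curve_connected K gm (fun a => a != 0) gm_pt).
- exact: closed_field_avoid.
- by move=> x; exists (gm_val x); rewrite ?gm_valK // gm_val_neq0.
- move=> p.
  (* clear the denominators of p(a, 1/a) *)
  exists (\sum_(m <- msupp p)
            p@_m *: 'X^(m ord0 + (msize p - m ord_max))) => a a0.
  rewrite -[RHS](inj_eq (mulIf (expf_neq0 (msize p) (invr_neq0 a0)))) mul0r.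
  congr (_ == 0); rewrite mevalE horner_sum mulr_suml !big_seq.
  apply: eq_bigr => m mp; rewrite hornerZ hornerXn -mulrA; congr (_ * _).
  rewrite big_ord_recl big_ord1 gm_coord_pt // !ffunE /=.
  have le_m : (m ord_max <= msize p)%N.
    apply: leq_trans (ltnW (msize_mdeg_lt mp)).
    by rewrite mdegE (bigD1 ord_max) //= leq_addr.
  have -> : lift ord0 ord0 = ord_max :> 'I_2 by apply: val_inj.
  rewrite exprD -mulrA; congr (_ * _).
  rewrite -[in a^-1 ^+ msize p](subnK le_m) exprD mulrA -exprMn divff //.
  by rewrite expr1n mul1r.
Qed.

End MultiplicativeGroup.

Section Scaling.
Variables (K : closedFieldType) (X : affvar K).
Implicit Types t : 'I_(adim X) -> K.

Definition preserves t := forall x : X,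
  vanish (aeqs X) [ffun k => t k * val x k].

(** A point that t would move out of X stays fixed; this keeps the map total. *)
Definition scale t (x : X) : X := insubd x [ffun k => t k * val x k].

Lemma scaleE t x k : preserves t -> val (scale t x) k = t k * val x k.
Proof. by move=> tX; rewrite val_insubd tX ffunE. Qed.

Lemma scale_comp t u : preserves t -> preserves u ->
  scale (fun k => t k * u k) = scale t \o scale u.
Proof.
move=> tX uX; have tuX : preserves (fun k => t k * u k).
  move=> x; have := tX (scale u x); congr (vanish _ _).
  by apply/funext => k; rewrite !ffunE scaleE // mulrA.
by apply/funext => x; apply: apoint_eq => k; rewrite !scaleE // mulrA.
Qed.

Lemma scale1 t : (forall k, t k = 1) -> scale t = id.
Proof.
move=> t1; apply/funext => x; apply: apoint_eq => k.
rewrite scaleE ?t1 ?mul1r // => y.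
have := valP y; congr (vanish _ _); apply/funext => j.
by rewrite ffunE t1 mul1r.
Qed.

(** Bezout coefficients u of the weights recover s as the product of the
    (s ^ w_k) ^ u_k, so the action is faithful: it can be read off at a point
    without zero coordinates. *)
Lemma primitive_weight_Aut_alg (w u : 'I_(adim X) -> int) :
  \sum_k u k * w k = 1 -> (exists x : X, forall k, val x k != 0) ->
  (forall s, s != 0 -> preserves (fun k => s ^ w k)) ->
  forall s, s != 0 -> Aut_alg (scale (fun k => s ^ w k)).
Proof.
move=> uw [x0 x0n] wX s s0.
pose act (a : gm K) := scale (fun k => gm_val a ^ w k).
have aX (a : gm K) : preserves (fun k => gm_val a ^ w k).
  exact/wX/gm_val_neq0.
have actP : faithful_regular_action act.
  split.
  - move=> k; exists (match w k with
      | Posz m => 'X_(lshift (adim X) ord0) ^+ m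
      | Negz m => 'X_(lshift (adim X) ord_max) ^+ m.+1 end
      * 'X_(rshift 2 k)) => a x.
    rewrite scaleE // mevalM mevalXU concat_r; congr (_ * _).
    case: (w k) => m; rewrite rmorphXn /= mevalXU concat_l //.
    by rewrite gm_val_inv exprVn.
  - by apply: scale1 => k; rewrite gm_ptK ?oner_neq0 // exp1rz.
  - move=> a b; rewrite /act -scale_comp //; congr scale; apply/funext => k.
    by rewrite gm_ptK ?mulf_neq0 ?gm_val_neq0 // expfzMl.
  - move=> a b e.
    have {}e k : gm_val a ^ w k = gm_val b ^ w k.
      apply: (mulIf (x0n k)).
      by have := congr1 (fun f : X -> X => val (f x0) k) e; rewrite !scaleE.
    have recover (c : gm K) : gm_val c = \prod_k (gm_val c ^ w k) ^ u k.
      rewrite -[LHS]expr1z -uw.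
      rewrite (big_morph _ (fun i j => expfzDr i j (gm_val_neq0 c)) (expr0z _)).
      by apply: eq_bigr => k _; rewrite exprz_exp mulrC.
    rewrite -[a]gm_valK -[b]gm_valK [gm_val a]recover [gm_val b]recover.
    by congr gm_pt; apply: eq_bigr => k _; rewrite e.
apply: (in_Aut_alg (range_connected_subgroup actP (@gm_connected K))).
by exists (gm_pt s); rewrite // /act gm_ptK.
Qed.

(** Dividing the weights by their greatest common divisor makes the action of
    the multiplicative group faithful without changing its image. *)
Lemma one_parameter_Aut_alg (w : 'I_(adim X) -> int) :
  (exists x : X, forall k, val x k != 0) ->
  (forall s, s != 0 -> preserves (fun k => s ^ w k)) ->
  forall s, s != 0 -> Aut_alg (scale (fun k => s ^ w k)).
Proof.
move=> X0 wX s s0; have [g [u [w' [wE gE]]]] := int_gcd_family w.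
have [g0|g0] := eqVneq g 0.
  rewrite scale1; first by have [] := Aut_alg_subgroup X.
  by move=> k; rewrite wE g0 mulr0 expr0z.
have -> : (fun k => s ^ w k) = (fun k => (s ^ g) ^ w' k).
  by apply/funext => k; rewrite wE mulrC exprz_exp.
apply: (primitive_weight_Aut_alg (u := u)) => //; last exact: expfz_neq0.
  apply: (mulIf g0); rewrite mul1r [RHS]gE mulr_suml.
  by apply: eq_bigr => k _; rewrite wE mulrA.
move=> r r0; have [z zE] : exists z : K, z ^ g = r.
  case: g {gE wE} g0 => m m0.
    by apply: closed_field_root; case: m m0.
  have [z e] := closed_field_root r^-1 (ltn0Sn m); exists z.
  by rewrite -[LHS]/((z ^+ m.+1)^-1) e invrK.
have -> : (fun k => r ^ w' k) = (fun k => z ^ w k).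
  by apply/funext => k; rewrite wE mulrC -zE exprz_exp.
apply: wX; apply: contraNneq r0 => z0; rewrite -zE z0 exp0rz.
by rewrite (negbTE g0).
Qed.

End Scaling.

(** * Density of the open set of points with non-zero coordinates *)

Section Trinomial.
Variables (K : closedFieldType) (n : nat).
Variables (blk : 'I_n -> 'I_3) (l : 'I_n -> nat).
Hypothesis charK : [pchar K] =i pred0.
Hypothesis l_gt0 : forall k, (0 < l k)%N.

Definition block_monomial (R : comPzRingType) (i : 'I_3) (x : 'I_n -> R) : R :=
  \prod_(k | blk k == i) x k ^+ l k.

Local Notation mu := block_monomial.

Definition tri_poly : {mpoly K[n]} := \sum_i mu i (fun k => 'X_k).

Definition tri_var : affvar K := @AffVar K n [:: tri_poly].

Definition on_tri (x : 'I_n -> K) : Prop := \sum_i mu i x = 0.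

Lemma meval_mu i (x : 'I_n -> K) :
  (mu i (fun k => 'X_k : {mpoly K[n]})).@[x] = mu i x.
Proof.
rewrite /block_monomial rmorph_prod; apply: eq_bigr => k _.
by rewrite rmorphXn /= mevalXU.
Qed.

Lemma vanish_triP (x : 'I_n -> K) : reflect (on_tri x) (vanish (aeqs tri_var) x).
Proof.
rewrite /vanish /= andbT raddf_sum /= (eq_bigr _ (fun i _ => meval_mu i x)).
exact: eqP.
Qed.

Lemma eq_mu i (x y : 'I_n -> K) : x =1 y -> mu i x = mu i y.
Proof. by move=> e; apply: eq_bigr => k _; rewrite e. Qed.

Lemma mu_eq0P i (x : 'I_n -> K) :
  reflect (exists2 k, blk k = i & x k = 0) (mu i x == 0).
Proof.
apply: (iffP (prodf_eq0 _ _)) => -[k /eqP bk].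
  by rewrite expf_eq0 => /andP[_ /eqP xk]; exists k.
by move=> xk; exists k; rewrite ?bk // xk expr0n gtn_eqF.
Qed.

Lemma mu_neq0 i (x : 'I_n -> K) : (forall k, blk k = i -> x k != 0) -> mu i x != 0.
Proof. by move=> xn; apply/mu_eq0P => -[k /xn/eqP]. Qed.

Lemma muM i (x y : 'I_n -> K) : mu i (fun k => x k * y k) = mu i x * mu i y.
Proof. by rewrite -big_split; apply: eq_bigr => k _; rewrite exprMn. Qed.

Definition blk0 : 'I_3 := @Ordinal 3 0 isT.
Definition blk1 : 'I_3 := @Ordinal 3 1 isT.
Definition blk2 : 'I_3 := @Ordinal 3 2 isT.

Lemma blk_cases (P : 'I_3 -> Prop) : P blk0 -> P blk1 -> P blk2 -> forall i, P i.
Proof.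
move=> P0 P1 P2 [[|[|[|//]]] i3]; [move: P0|move: P1|move: P2];
  by congr (P _); apply: val_inj.
Qed.

Lemma sum_blk (F : 'I_3 -> K) : \sum_i F i = F blk0 + F blk1 + F blk2.
Proof.
rewrite !big_ord_recr big_ord0 /= add0r.
by congr (F _ + F _ + F _); apply: val_inj.
Qed.

Hypotheses (blk1_ex : exists k, blk k = blk1) (blk2_ex : exists k, blk k = blk2).

Lemma other_block i : exists e, blk e != i.
Proof.
have [k1 k1E] := blk1_ex; have [k2 k2E] := blk2_ex.
have [i1|] := eqVneq i blk1; first by exists k2; rewrite k2E i1.
by exists k1; rewrite k1E eq_sym.
Qed.

(** Let all zero coordinates of y, which lie in the block i, be equal to s, and
    let one coordinate of another block vary with value r. This cuts X in a
    curve s^m = h(r), and y is a branch point of it over a root of h. *)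
Lemma density_one_zero_block (p : {mpoly K[n]}) i y :
  (forall x, on_tri x -> (forall k, x k != 0) -> p.@[x] = 0) ->
  on_tri y -> mu i y = 0 -> (forall k, blk k != i -> y k != 0) -> p.@[y] = 0.
Proof.
move=> pZ yX yi yn; have [e ei] := other_block i.
pose Z k := (blk k == i) && (y k == 0).
pose c k : {poly {poly K}} :=
  if k == e then 'X%:P else if Z k then 'X else (y k)%:P%:P.
pose x r s k := if k == e then r else if Z k then s else y k.
have Ze : Z e = false by rewrite /Z (negbTE ei).
have cE r s k : (c k).[s%:P].[r] = x r s k.
  by rewrite /c /x; case: ifP => _; [|case: ifP => _]; rewrite !hornerE.
pose G := mmap (polyC \o polyC) c p.
have GE r s : G.[s%:P].[r] = p.@[x r s].
  have := @meval_morph K n {poly {poly K}} (polyC \o polyC)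
    (horner_eval r \o horner_eval s%:P) c p.
  rewrite /= /horner_eval => -> => [|z]; last by rewrite /= !hornerC.
  by apply: meval_eq => k; rewrite cE.
have xy : x (y e) 0 =1 y.
  move=> k; rewrite /x; case: eqP => [->//|_].
  by rewrite /Z; case: ifP => // /andP[_ /eqP->].
rewrite -(meval_eq p xy) -GE polyC0.
pose m := (\sum_(k | Z k) l k)%N.
pose kap := \prod_(k | (blk k == i) && (y k != 0)) y k ^+ l k.
pose b := \prod_(k | (blk k == blk e) && (k != e)) y k ^+ l k.
(* the monomials of the blocks other than i and that of e do not vary *)
pose gam := \sum_(j | (j != i) && (j != blk e)) mu j y.
have kap0 : kap != 0.
  by apply/prodf_neq0 => k /andP[_ yk]; rewrite expf_neq0.
have b0 : b != 0.
  by apply/prodf_neq0 => k /andP[/eqP bk _]; rewrite expf_neq0 // yn // bk.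
have m0 : (0 < m)%N.
  have /eqP/mu_eq0P[k bk yk] := yi.
  by rewrite /m (bigD1 k) /Z ?bk ?yk ?eqxx // addn_gt0 l_gt0.
have muE r s : \sum_j mu j (x r s) = kap * s ^+ m + (b * r ^+ l e + gam).
  rewrite (bigD1 i) //= (bigD1 (blk e)) //=; congr (_ + (_ + _)).
  - rewrite /block_monomial (bigID (fun k => y k == 0)) /= mulrC; congr (_ * _).
      apply: eq_bigr => k /andP[/eqP bk yk]; congr (_ ^+ _).
      rewrite /x /Z (negbTE yk) andbF; case: eqP => // ke.
      by move: ei; rewrite -ke bk eqxx.
    rewrite -prodrXr; apply: eq_big => // k /andP[/eqP bk yk].
    rewrite /x /Z bk yk eqxx /=; case: eqP => // ke.
    by move: ei; rewrite -ke bk eqxx.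
  - rewrite /block_monomial (bigD1 e) //= mulrC /x eqxx; congr (_ * _).
    apply: eq_bigr => k /andP[/eqP bk /negbTE ke].
    by rewrite ke /Z bk (negbTE ei).
  - apply: eq_bigr => j /andP[ji je]; apply: eq_bigr => k /eqP bk.
    rewrite /x /Z bk (negbTE ji); case: eqP => // ke.
    by move: je; rewrite -ke bk eqxx.
pose h := - kap^-1 *: (b *: 'X^(l e) + gam%:P).
have hE r : h.[r] = - kap^-1 * (b * r ^+ l e + gam).
  by rewrite /h !hornerE.
apply: (@cyclic_cover_branch K charK m h) => //.
- apply: contraTneq isT => /polyP/(_ (l e)).
  rewrite coef0 coefZ coefD coefZ coefXn eqxx coefC gtn_eqF // addr0 mulr1.
  by move/eqP; rewrite mulf_eq0 oppr_eq0 invr_eq0 (negbTE kap0) (negbTE b0).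
- move=> r s r0 s0 sr; rewrite GE; apply: pZ.
    rewrite /on_tri muE sr hE mulrA mulrN divff // mulN1r.
    by rewrite addNr.
  move=> k; rewrite /x; case: (k == e) => //.
  by case Zk: (Z k) => //; move/negbT: Zk; rewrite negb_and => /orP[/yn|].
- have : \sum_j mu j (x (y e) 0) = 0.
    by rewrite -[RHS]yX; apply: eq_bigr => j _; apply: eq_mu.
  rewrite muE hE expr0n gtn_eqF // mulr0 add0r => ->.
  by rewrite mulr0.
Qed.

(** Here y lies on a rational curve inside mu_0 = 0: the zero coordinates of
    the blocks 1 and 2 become powers of a parameter s, with exponents for which
    mu_1 and mu_2 have the same order in s, and a constant factor om in front of
    one of them makes mu_1 + mu_2 vanish identically. *)
Lemma density_all_zero (p : {mpoly K[n]}) y :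
  (forall x, on_tri x -> mu blk0 x = 0 -> (forall k, blk k != blk0 -> x k != 0) ->
     p.@[x] = 0) ->
  (forall i, mu i y = 0) -> p.@[y] = 0.
Proof.
move=> pZ y0.
pose S j := (\sum_(k | (blk k == j) && (y k == 0%R)) l k)%N.
have S_gt0 j : (0 < S j)%N.
  have /eqP/mu_eq0P[k bk yk] := y0 j.
  by rewrite /S (bigD1 k) ?bk ?yk ?eqxx // addn_gt0 l_gt0.
pose kap j := \prod_(k | (blk k == j) && (y k != 0)) y k ^+ l k.
have kap0 j : kap j != 0.
  by apply/prodf_neq0 => k /andP[_ yk]; rewrite expf_neq0.
have /eqP/mu_eq0P[e be ye] := y0 blk2.
have [om omE] := closed_field_root (- (kap blk1 / kap blk2)) (l_gt0 e).
have om0 : om != 0.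
  apply: contraTneq isT => om0; move/eqP: omE.
  rewrite om0 expr0n gtn_eqF // eq_sym oppr_eq0 mulf_eq0 invr_eq0.
  by rewrite !(negbTE (kap0 _)).
pose dir k := if k == e then om else 1.
pose ex j := if j == blk1 then S blk2 else S blk1.
pose x s k := if (y k != 0) || (blk k == blk0) then y k
              else dir k * s ^+ ex (blk k).
pose c k : {poly K} := if (y k != 0) || (blk k == blk0) then (y k)%:P
              else dir k *: 'X^(ex (blk k)).
have cE s k : (c k).[s] = x s k by rewrite /c /x; case: ifP; rewrite !hornerE.
have xy : x 0 =1 y.
  move=> k; rewrite /x; case: ifP => // /norP[/negPn/eqP-> _].
  rewrite expr0n gtn_eqF ?mulr0 // /ex.
  by case: ifP.
have muE s j : j != blk0 -> mu j (x s) =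
    kap j * \prod_(k | (blk k == j) && (y k == 0)) dir k ^+ l k * s ^+ (ex j * S j).
  move=> j0; rewrite /block_monomial (bigID (fun k => y k == 0)) /= mulrC -mulrA.
  congr (_ * _).
    by apply: eq_bigr => k /andP[_ yk]; rewrite /x yk.
  rewrite exprM -prodrXr -big_split /=; apply: eq_bigr => k /andP[/eqP bk yk].
  by rewrite /x yk bk (negbTE j0) /= exprMn.
have mu0 s : mu blk0 (x s) = 0.
  rewrite -(y0 blk0); apply: eq_bigr => k bk.
  by rewrite /x bk orbT.
rewrite -(meval_eq p xy) -(meval_eq p (cE 0)) -horner_mmap.
suff -> : mmap polyC c p = 0 by rewrite horner0.
apply/eqP; apply: contraT => q0.
have [|s] := PreClosedField.closed_nonrootP (@solve_monicpoly K)
  ('X * mmap polyC c p) _; first by rewrite mulf_neq0 // polyX_eq0.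
rewrite rootM negb_or /root hornerX => /andP[s0 /eqP[]].
rewrite horner_mmap (meval_eq p (cE s)); apply: pZ => //.
- rewrite /on_tri sum_blk mu0 add0r !muE // /ex eqxx /=.
  rewrite [X in _ * X * _ + _]big1; last first.
    move=> k /andP[/eqP bk _]; rewrite /dir; case: eqP => [ke|_].
      by move: be; rewrite -ke bk.
    by rewrite expr1n.
  rewrite [X in _ + _ * X * _](bigD1 e) ?be ?ye ?eqxx //= big1; last first.
    by move=> k /andP[_ /negbTE ke]; rewrite /dir ke expr1n.
  rewrite /dir eqxx omE !mulr1 mulrN mulrCA divff // mulr1 mulnC.
  by rewrite mulNr subrr.
- move=> k /negbTE bk; rewrite /x bk orbF; case: ifP => // _.
  by rewrite mulf_neq0 ?expf_neq0 // /dir; case: ifP; rewrite ?oner_neq0.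
Qed.

Lemma two_zero_blocks x i j :
  on_tri x -> i != j -> mu i x = 0 -> mu j x = 0 -> forall i', mu i' x = 0.
Proof.
rewrite /on_tri sum_blk.
move: i j; apply: blk_cases; apply: blk_cases => // e _ e1 e2;
  apply: blk_cases => //; move: e; rewrite ?e1 ?e2 ?add0r ?addr0 //.
Qed.

(** Two vanishing monomials force the third one to vanish, so that either one
    monomial or all three vanish. *)
Lemma zero_block_cases x i : on_tri x -> mu i x = 0 ->
  (forall k, blk k != i -> x k != 0) \/ (forall j, mu j x = 0).
Proof.
move=> xX xi; case: (pselect (forall k, blk k != i -> x k != 0)) => [|h]; first by left.
right; move/existsNP: h => [k /not_implyP[bk /negP/negPn/eqP xk]].
apply: (@two_zero_blocks x i (blk k)) => //; first by rewrite eq_sym.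
by apply/eqP/mu_eq0P; exists k.
Qed.

Lemma density (p : {mpoly K[n]}) y :
  (forall x, on_tri x -> (forall k, x k != 0) -> p.@[x] = 0) ->
  on_tri y -> p.@[y] = 0.
Proof.
move=> pZ yX; case: (pselect (forall k, y k != 0)) => [|/existsNP[k]]; first exact: pZ.
move=> /negP/negPn/eqP yk.
have yi : mu (blk k) y = 0 by apply/eqP/mu_eq0P; exists k.
have [yn|y0] := zero_block_cases yX yi.
  exact: density_one_zero_block yi yn.
apply: density_all_zero y0 => x xX x0 xn.
exact: density_one_zero_block x0 xn.
Qed.

End Trinomial.

(** * The diagonal torus *)

Section Torus.
Variables (K : closedFieldType) (n : nat).
Variables (blk : 'I_n -> 'I_3) (l : 'I_n -> nat).
Hypothesis l_gt0 : forall k, (0 < l k)%N.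
Local Notation X := (tri_var K blk l).
Local Notation mu := (block_monomial blk l).
Implicit Types t u h r : 'I_n -> K.

(** This group is in general not connected. When block 0 is empty, mu_0 is 1
    and the common value is 1. *)
Definition torus t := (forall k, t k != 0) /\ forall i j, mu i t = mu j t.

Lemma torusM t u : torus t -> torus u -> torus (fun k => t k * u k).
Proof.
move=> [t0 te] [u0 ue]; split=> [k|i j]; first by rewrite mulf_neq0.
by rewrite !muM (te i j) (ue i j).
Qed.

Lemma mu1 i : mu i (fun=> 1 : K) = 1.
Proof. by rewrite /block_monomial big1 // => k _; rewrite expr1n. Qed.

Lemma torusV t : torus t -> torus (fun k => (t k)^-1).
Proof.
move=> [t0 te]; split=> [k|i j]; first by rewrite invr_eq0.
have muV i' : mu i' (fun k => (t k)^-1) = (mu i' t)^-1.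
  by rewrite /block_monomial -prodfV; apply: eq_bigr => k _; rewrite exprVn.
by rewrite !muV (te i j).
Qed.

Lemma torus_preserves t : torus t -> preserves (X := X) t.
Proof.
move=> [t0 te] x; apply/vanish_triP; rewrite /on_tri.
have /vanish_triP xX := valP x.
rewrite -[RHS](mulr0 (mu blk0 t)) -[in RHS]xX mulr_sumr.
apply: eq_bigr => i _; rewrite (te _ i) -muM.
by apply: eq_mu => k; rewrite ffunE.
Qed.

Lemma torusVK t : torus t ->
  cancel (scale (X := X) t) (scale (X := X) (fun k => (t k)^-1)).
Proof.
move=> tT x.
rewrite -[LHS]/((scale (X := X) (fun k => (t k)^-1) \o scale (X := X) t) x).
rewrite -scale_comp; [|exact/torus_preserves/torusV|exact/torus_preserves].
by rewrite scale1 // => k; rewrite mulVf // tT.1.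
Qed.

Lemma torusKV t : torus t ->
  cancel (scale (X := X) (fun k => (t k)^-1)) (scale (X := X) t).
Proof.
move=> tT x.
rewrite -[LHS]/((scale (X := X) t \o scale (X := X) (fun k => (t k)^-1)) x).
rewrite -scale_comp; [|exact/torus_preserves|exact/torus_preserves/torusV].
by rewrite scale1 // => k; rewrite mulfV // tT.1.
Qed.

Lemma scale_regular t : torus t -> regular_map (scale (X := X) t).
Proof.
move=> tT k; exists (t k *: 'X_k) => x.
by rewrite mevalZ mevalXU scaleE //; apply: torus_preserves.
Qed.

Lemma torus_weight (w : 'I_n -> int) :
  (forall i j, \sum_(k | blk k == i) w k * (l k)%:Z
             = \sum_(k | blk k == j) w k * (l k)%:Z) ->
  forall s : K, s != 0 -> torus (fun k => s ^ w k).
Proof.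
move=> we s s0; split=> [k|i j]; first exact: expfz_neq0.
suff muE i' : mu i' (fun k => s ^ w k) = s ^ (\sum_(k | blk k == i') w k * (l k)%:Z).
  by rewrite !muE (we i j).
rewrite (big_morph _ (fun a b => expfzDr a b s0) (expr0z _)).
by apply: eq_bigr => k _; rewrite -exprz_exp.
Qed.

Hypothesis X_open : exists x : X, forall k, val x k != 0.

Definition torus_Aut_alg h := torus h /\ Aut_alg (scale (X := X) h).

Lemma torus_Aut_algM t u : torus_Aut_alg t -> torus_Aut_alg u ->
  torus_Aut_alg (fun k => t k * u k).
Proof.
move=> [tT tA] [uT uA]; split; first exact: torusM.
rewrite scale_comp; try exact: torus_preserves.
by have [_ _ Ac _] := Aut_alg_subgroup X; apply: Ac.
Qed.

Lemma torus_Aut_algV t : torus_Aut_alg t -> torus_Aut_alg (fun k => (t k)^-1).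
Proof.
move=> [tT tA]; split; first exact: torusV.
have [_ _ _ Ai] := Aut_alg_subgroup X.
by apply: Ai tA _ _; [apply: torusVK|apply: torusKV].
Qed.

Lemma torus_weight_Aut_alg (w : 'I_n -> int) :
  (forall i j, \sum_(k | blk k == i) w k * (l k)%:Z
             = \sum_(k | blk k == j) w k * (l k)%:Z) ->
  forall s : K, s != 0 -> torus_Aut_alg (fun k => s ^ w k).
Proof.
move=> we s s0; split; first exact: torus_weight.
apply: one_parameter_Aut_alg => // r r0.
exact/torus_preserves/torus_weight.
Qed.

(** A distinguished coordinate in every non-empty block. *)
Lemma base_point : exists e : 'I_3 -> option 'I_n,
  forall i, match e i with Some k => blk k = i | None => forall k, blk k != i end.
Proof.
exists (fun i => [pick k | blk k == i]) => i.
by case: pickP => [k /eqP//|h k]; rewrite h.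
Qed.

Variable e : 'I_3 -> option 'I_n.
Hypothesis eP : forall i,
  match e i with Some k => blk k = i | None => forall k, blk k != i end.

Lemma base_ex k : exists2 k', e (blk k) = Some k' & blk k' = blk k.
Proof.
have := eP (blk k); case: (e (blk k)) => [k' bk|/(_ k)]; first by exists k'.
by rewrite eqxx.
Qed.

Definition is_base k := e (blk k) == Some k.

(** Inside a block, the weights (l_b, - l_k) on a coordinate k and the base
    coordinate b keep the monomial fixed, so every coordinate other than the
    base ones can be normalised to 1. *)
Lemma normalise_nonbase t (s : seq 'I_n) : torus t -> exists2 h,
  torus_Aut_alg h & forall k, k \in s -> ~~ is_base k -> h k * t k = 1.
Proof.
move=> tT; elim: s => [|k s [h hA hs]].
  exists (fun=> 1) => //; split.
    by split=> [k|i j]; rewrite ?oner_neq0 // !mu1.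
  by rewrite scale1 //; have [] := Aut_alg_subgroup X.
have [kb|kb] := boolP (is_base k).
  by exists h => // j; rewrite inE => /orP[/eqP->|]; [rewrite kb|apply: hs].
have [b be bb] := base_ex k.
have bk : b != k by apply: contraNneq kb => bk; rewrite /is_base be bk.
pose w j : int := if j == k then (l b)%:Z else if j == b then - (l k)%:Z else 0.
have wE i : \sum_(j | blk j == i) w j * (l j)%:Z = 0.
  have [<-|ik] := eqVneq (blk k) i.
    rewrite (bigD1 k) //= (bigD1 b) /=; last by rewrite bb eqxx bk.
    rewrite big1; last first.
      by move=> j /andP[/andP[_ /negbTE jk] /negbTE jb]; rewrite /w jk jb mul0r.
    by rewrite /w eqxx (negbTE bk) eqxx addr0 mulNr mulrC subrr.
  apply: big1 => j /eqP ji; rewrite /w; case: eqP => [jk|_].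
    by move: ik; rewrite -ji jk eqxx.
  case: eqP => [jb|_]; last by rewrite mul0r.
  by move: ik; rewrite -ji jb bb eqxx.
have htk0 : h k * t k != 0 by rewrite mulf_neq0 ?hA.1.1 ?tT.1.
have [s0 s0E] := closed_field_root (h k * t k)^-1 (l_gt0 b).
have s00 : s0 != 0.
  apply: contraTneq isT => z; move/eqP: s0E.
  by rewrite z expr0n gtn_eqF // eq_sym invr_eq0 (negbTE htk0).
exists (fun j => s0 ^ w j * h j).
  apply: torus_Aut_algM hA.
  by apply: torus_weight_Aut_alg => // i j; rewrite !wE.
move=> j; have [-> _ _|jk] := eqVneq j k.
  rewrite /w eqxx -mulrA.
  by rewrite [s0 ^ _](_ : _ = s0 ^+ l b) // s0E mulVf.
rewrite inE (negbTE jk) /= => js jb.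
rewrite /w (negbTE jk); case: eqP => [jeb|_].
  by move: jb; rewrite jeb /is_base bb be eqxx.
by rewrite expr0z mul1r hs.
Qed.

(** Once the other coordinates are 1, the base coordinates satisfy
    u_b ^ l_b = v for one common v. If no block is empty, the weights N / l_b on
    the base coordinates multiply v by an N-th power, which makes it 1; if a
    block is empty, v is 1 already. *)
Lemma torus_decomposition t : torus t -> exists h r,
  [/\ torus_Aut_alg h, forall k, r k ^+ l k = 1 & forall k, t k = h k * r k].
Proof.
move=> tT; have [h hA ht] := normalise_nonbase (enum 'I_n) tT.
have {}ht k : ~~ is_base k -> h k * t k = 1 by apply: ht; rewrite mem_enum.
pose u k := h k * t k; have uT : torus u by apply: torusM => //; apply: hA.1.
have muu k : is_base k -> mu (blk k) u = u k ^+ l k.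
  move=> kb; rewrite /block_monomial (bigD1 k) //= big1 ?mulr1 // => j /andP[/eqP bj jk].
  rewrite /u ht ?expr1n // /is_base bj.
  by apply: contra jk => /eqP; move/eqP: kb => -> [->].
have [g [gA gu]] : exists g, torus_Aut_alg g /\ forall k, (g k * u k) ^+ l k = 1.
  (* g makes the common value of the u_b ^ l_b equal to 1 *)
  have [full|] := pselect (forall i, exists k, e i = Some k); last first.
    move=> /existsNP[i ei].
    have mui : mu i u = 1.
      rewrite /block_monomial big_pred0 // => k; apply/negbTE.
      have := eP i; case E: (e i) => [k'|]; last by [].
      by case: ei; exists k'.
    exists (fun=> 1); split.
      split; first by split=> [k|i' j]; rewrite ?oner_neq0 // !mu1.
      by rewrite scale1 //; have [] := Aut_alg_subgroup X.
    move=> k; rewrite mul1r; have [kb|kb] := boolP (is_base k).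
      by rewrite -muu // (uT.2 _ i).
    by rewrite /u ht // expr1n.
  pose b i := projT1 (cid (full i)).
  have bE i : e i = Some (b i) := projT2 (cid (full i)).
  have bb i : blk (b i) = i by have := eP i; rewrite bE.
  pose N := (\prod_i l (b i))%N.
  pose w k : int := if is_base k then (\prod_(i | i != blk k) l (b i))%N%:Z else 0.
  have wl k : is_base k -> w k * (l k)%:Z = N%:Z.
    move=> kb; have bk : b (blk k) = k.
      by move/eqP: (kb); rewrite bE => -[].
    by rewrite /w kb /N [in RHS](bigD1 (blk k)) //= bk mulnC PoszM.
  have wE i : \sum_(j | blk j == i) w j * (l j)%:Z = N%:Z.
    rewrite (bigD1 (b i)) /= ?bb // wl ?/is_base ?bb ?bE //.
    rewrite big1 ?addr0 // => j /andP[/eqP bj jb].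
    rewrite /w /is_base bj bE; case: eqP => [[jb']|]; last by rewrite mul0r.
    by move: jb; rewrite jb' eqxx.
  have N0 : (0 < N)%N by apply: prodn_gt0.
  have v0 : mu blk0 u != 0.
    by apply: mu_neq0 => // k _; apply: uT.1.
  have [s sE] := closed_field_root (mu blk0 u)^-1 N0.
  have s0 : s != 0.
    apply: contraTneq isT => z; move/eqP: sE.
    by rewrite z expr0n gtn_eqF // eq_sym invr_eq0 (negbTE v0).
  exists (fun k => s ^ w k); split.
    by apply: torus_weight_Aut_alg => // i j; rewrite !wE.
  move=> k; have [kb|kb] := boolP (is_base k).
    rewrite exprMn -muu // (uT.2 _ blk0).
    have -> : (s ^ w k) ^+ l k = s ^+ N.
      by rewrite -[LHS]/((s ^ w k) ^ (l k)%:Z) exprz_exp wl.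
    by rewrite sE mulVf.
  by rewrite /w (negbTE kb) expr0z mul1r /u ht // expr1n.
exists (fun k => (g k * h k)^-1), (fun k => g k * u k); split=> //.
  exact/torus_Aut_algV/torus_Aut_algM.
move=> k; rewrite /u [g k * (_ * _)]mulrA mulKf //.
by rewrite mulf_neq0 ?gA.1.1 ?hA.1.1.
Qed.

End Torus.

(** * Torus orbits *)

Section Trinomial.
Variables (K : closedFieldType) (n : nat).
Variables (blk : 'I_n -> 'I_3) (l : 'I_n -> nat).
Hypothesis l_gt0 : forall k, (0 < l k)%N.
Local Notation X := (tri_var K blk l).
Local Notation mu := (block_monomial blk l).

Lemma point_on_tri (x : X) : on_tri blk l (val x).
Proof. by have /vanish_triP := valP x. Qed.

Lemma on_tri_point x : on_tri (K := K) blk l x -> exists z : X, val z =1 x.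
Proof.
move=> xX; have zX : vanish (aeqs X) [ffun k => x k].
  apply/vanish_triP; rewrite /on_tri -[RHS]xX; apply: eq_bigr => i _.
  by apply: eq_mu => k; rewrite ffunE.
exists (exist (fun y : {ffun 'I_n -> K} => is_true (vanish (aeqs X) y)) _ zX).
by move=> k; rewrite ffunE.
Qed.

(** Up to sign, the three minors of two triples with zero sum are equal. *)
Lemma proportional_sums (a b : 'I_3 -> K) i0 j0 :
  \sum_i a i = 0 -> \sum_i b i = 0 -> i0 != j0 ->
  a i0 * b j0 = a j0 * b i0 -> forall i j, a i * b j = a j * b i.
Proof.
rewrite !sum_blk => /eqP + /eqP; rewrite !(addrC _ (_ blk2)) !addr_eq0.
move=> /eqP ea /eqP eb; pose m i j := a i * b j - a j * b i.
have mC i j : m j i = - m i j by rewrite /m opprB.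
have m12 : m blk1 blk2 = m blk0 blk1 by rewrite /m ea eb; ring.
have m20 : m blk2 blk0 = m blk0 blk1 by rewrite /m ea eb; ring.
have m01 i j : i != j -> m i j = 0 -> m blk0 blk1 = 0.
  move: i j; apply: blk_cases; apply: blk_cases => // _.
  - by rewrite mC m20 => /eqP; rewrite oppr_eq0 => /eqP.
  - by rewrite mC => /eqP; rewrite oppr_eq0 => /eqP.
  - by rewrite m12.
  - by rewrite m20.
  - by rewrite mC m12 => /eqP; rewrite oppr_eq0 => /eqP.
move=> ij /eqP; rewrite -subr_eq0 => /eqP/(m01 _ _ ij) m0 i j.
apply/eqP; rewrite -subr_eq0 -/(m i j); apply/eqP; move: i j.
by apply: blk_cases; apply: blk_cases;
  rewrite ?(mC blk2 blk0) ?(mC blk0 blk1) ?(mC blk1 blk2) ?m12 ?m20 ?m0 ?oppr0 //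
   /m subrr.
Qed.

Definition same_zeros (x y : X) := forall k, (val x k == 0) = (val y k == 0).

(** On the non-zero coordinates the torus element has to be the quotient y / x,
    which multiplies every non-vanishing monomial by the same factor v. On the
    zero coordinates it is free, and this freedom serves to give the other
    monomials the factor v too. *)
Lemma same_torus_orbit (x y : X) : same_zeros x y ->
  (exists i j, i != j /\ mu i (val x) * mu j (val y) = mu j (val x) * mu i (val y)) ->
  exists2 t, torus blk l t & y = scale (X := X) t x.
Proof.
move=> xy [i0 [j0 [ij /(proportional_sums (point_on_tri x) (point_on_tri y) ij)]]].
move=> prop.
pose full i := forall k, blk k = i -> val x k != 0.
(* if no monomial is non-zero at x, the factor is arbitrary *)
have [v v0 vE] : exists2 v, v != 0 &
    forall i, full i -> mu i (val y) = v * mu i (val x).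
  case: (pselect (exists i, full i)) => [[j jf]|h].
    have mx : mu j (val x) != 0 by apply: mu_neq0.
    have my : mu j (val y) != 0 by apply: mu_neq0 => // k /jf; rewrite xy.
    exists (mu j (val y) / mu j (val x)); first by rewrite mulf_neq0 ?invr_eq0.
    move=> i _; rewrite mulrAC; apply: (mulIf mx).
    by rewrite mulfVK // [LHS]mulrC [RHS]mulrC prop.
  by exists 1; rewrite ?oner_neq0 // => i fi; case: h; exists i.
pose t0 k := if val x k == 0 then 1 else val y k / val x k.
have t00 k : t0 k != 0.
  rewrite /t0; case: ifP => [|/negbT xk]; first by rewrite oner_neq0.
  by rewrite mulf_neq0 ?invr_eq0 // -xy.
have tau_ex i : exists tau : 'I_n -> K, [/\ forall k, tau k != 0,
    forall k, val x k != 0 -> tau k = 1 & mu i (fun k => t0 k * tau k) = v].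
  have [fi|] := pselect (full i).
    exists (fun=> 1); split=> // [k|]; first exact: oner_neq0.
    have mx : mu i (val x) != 0 by apply: mu_neq0.
    apply: (mulIf mx); rewrite -vE // -muM; apply: eq_bigr => k /eqP bk.
    by rewrite /t0 (negbTE (fi k bk)) mulr1 divfK // fi.
  move=> /existsNP[e /not_implyP[be /negP/negPn/eqP xe]].
  have m0 : mu i t0 != 0 by apply: mu_neq0.
  have [rho rE] := closed_field_root (v / mu i t0) (l_gt0 e).
  have r0 : rho != 0.
    apply: contraTneq isT => z; move/eqP: rE.
    by rewrite z expr0n gtn_eqF // eq_sym mulf_eq0 invr_eq0 (negbTE v0) (negbTE m0).
  exists (fun k => if k == e then rho else 1); split=> [k|k|].
  - by case: ifP; rewrite ?oner_neq0.
  - by have [->|//] := eqVneq k e; rewrite xe eqxx.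
  rewrite muM [X in _ * X](_ : _ = rho ^+ l e) ?rE; first by rewrite mulrC divfK.
  rewrite /block_monomial (bigD1 e) ?be //= eqxx big1 ?mulr1 // => k /andP[_ /negbTE->].
  by rewrite expr1n.
pose tau i := projT1 (cid (tau_ex i)).
have tau0 i k : tau i k != 0.
  by have [h _ _] := projT2 (cid (tau_ex i)); apply: h.
have tau1 i k : val x k != 0 -> tau i k = 1.
  by have [_ h _] := projT2 (cid (tau_ex i)); apply: h.
have tauv i : mu i (fun k => t0 k * tau i k) = v.
  by have [] := projT2 (cid (tau_ex i)).
pose t k := t0 k * tau (blk k) k.
have muv i : mu i t = v.
  by rewrite -(tauv i); apply: eq_bigr => k /eqP bk; rewrite /t bk.
have tT : torus blk l t.
  by split=> [k|i j]; rewrite ?muv // mulf_neq0.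
exists t => //; apply: apoint_eq => k; rewrite scaleE; last exact: torus_preserves.
have [xk|xk] := eqVneq (val x k) 0.
  by rewrite xk mulr0; apply/eqP; rewrite -xy xk.
by rewrite /t tau1 // mulr1 /t0 (negbTE xk) divfK.
Qed.

End Trinomial.

(** * Moving the ratio of two monomials *)

Section Trinomial.
Variables (K : closedFieldType) (n : nat).
Variables (blk : 'I_n -> 'I_3) (l : 'I_n -> nat).
Hypothesis charK : [pchar K] =i pred0.
Hypothesis l_gt0 : forall k, (0 < l k)%N.
Hypotheses (blk1_ex : exists k, blk k = blk1) (blk2_ex : exists k, blk k = blk2).
Local Notation X := (tri_var K blk l).
Local Notation mu := (block_monomial blk l).

Definition open_pt (x : X) := forall k, val x k != 0.

Lemma density_points (p : {mpoly K[n]}) :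
  (forall x : X, open_pt x -> p.@[val x] = 0) -> forall x : X, p.@[val x] = 0.
Proof.
move=> pZ x; apply: density (point_on_tri x) => // y yX y0.
have [z zE] := on_tri_point yX.
by rewrite -(meval_eq p zE); apply: pZ => k; rewrite zE.
Qed.

Lemma regular_map_mu (f : X -> X) i : regular_map f ->
  exists p : {mpoly K[n]}, forall x : X, p.@[val x] = mu i (val (f x)).
Proof.
move=> fr; pose P k := projT1 (cid (fr k)).
have PE k x : val (f x) k = (P k).@[val x] := projT2 (cid (fr k)) x.
exists (mu i P) => x; rewrite /block_monomial rmorph_prod; apply: eq_bigr => k _.
by rewrite rmorphXn /= -PE.
Qed.

Section Flow.
Variable D : {linear coord_ring X -> coord_ring X}.
Hypotheses (derD : derivation D) (nilD : locally_nilpotent D).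
Hypothesis D0 : ~ (forall f, D f = 0).

Local Notation phi := (flow charK derD nilD).

Lemma flow_regular t : regular_map (phi t).
Proof.
have := @regular_map2_left _ _ _ _ _ (ga_pt t) (ga_act_regular charK derD nilD).
by rewrite /ga_act ga_ptK.
Qed.

(** If the flow preserved mu_0 / mu_1 on the open set, it would preserve each
    hypersurface mu_i = 0 at its points off the common zero locus of the three
    monomials, and by density the union of these hypersurfaces. So on an orbit
    starting in the open set the coordinates would be nowhere vanishing
    polynomials in the time, that is, constants, and the derivation would vanish
    on the open set, hence everywhere. *)
Lemma flow_moves_ratio : exists (x : X) t, open_pt x /\
  mu blk0 (val (phi t x)) * mu blk1 (val x) !=
  mu blk0 (val x) * mu blk1 (val (phi t x)).
Proof.
apply: contrapT => h.
have rel01 t x : mu blk0 (val (phi t x)) * mu blk1 (val x) =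
    mu blk0 (val x) * mu blk1 (val (phi t x)).
  have [p0 p0E] := regular_map_mu blk0 (flow_regular t).
  have [p1 p1E] := regular_map_mu blk1 (flow_regular t).
  pose X_ k : {mpoly K[n]} := 'X_k.
  have := @density_points (p0 * mu blk1 X_ - mu blk0 X_ * p1) _ x.
  rewrite mevalB !mevalM p0E p1E !meval_mu => /(_ _)/subr0_eq; apply => y y0.
  rewrite mevalB !mevalM p0E p1E !meval_mu; apply/eqP; rewrite subr_eq0.
  by apply: contraT => ne; case: h; exists y, t.
have rel t x i j : mu i (val (phi t x)) * mu j (val x) =
    mu j (val (phi t x)) * mu i (val x).
  apply: (@proportional_sums _ (fun i => mu i (val (phi t x)))
    (fun i => mu i (val x)) blk0 blk1) => //; try exact: point_on_tri.
  by rewrite rel01 mulrC.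
have one_zero t (x : X) i : mu i (val x) = 0 -> (forall k, blk k != i -> val x k != 0) ->
    mu i (val (phi t x)) = 0.
  move=> xi xn; have [e ei] := other_block blk1_ex blk2_ex i.
  have xe : mu (blk e) (val x) != 0.
    by apply: mu_neq0 => // k bk; apply: xn; rewrite bk.
  by apply: (mulIf xe); rewrite rel xi mulr0 mul0r.
have closed_inv t (x : X) k : val x k = 0 -> exists k', val (phi t x) k' = 0.
  move=> xk; have xi : mu (blk k) (val x) = 0 by apply/eqP/mu_eq0P => //; exists k.
  have [xn|x0] := zero_block_cases l_gt0 (point_on_tri x) xi.
    have /eqP/(mu_eq0P _ l_gt0)[k' _ k'0] := one_zero t x _ xi xn.
    by exists k'.
  have [p pE] := regular_map_mu blk0 (flow_regular t).
  suff : mu blk0 (val (phi t x)) = 0.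
    by move=> /eqP/(mu_eq0P _ l_gt0)[k' _ k'0]; exists k'.
  rewrite -pE; apply: (density_all_zero l_gt0 _ x0) => y yX y0 yn.
  have [z zE] := on_tri_point yX.
  rewrite -(meval_eq p zE) pE; apply: one_zero.
    by rewrite -y0; apply: eq_mu.
  by move=> k' /yn; rewrite zE.
have open_inv t x : open_pt x -> open_pt (phi t x).
  move=> xn k; apply/eqP => /(closed_inv (- t))[k'].
  by rewrite flowK; apply/eqP.
have fixed t x : open_pt x -> phi t x = x.
  move=> xn; apply: apoint_eq => k.
  have -> : val x k = val (phi 0 x) k by rewrite (flow0 charK derD nilD).
  rewrite !ffunE.
  set q := expo _ _ _.
  have /negPn/eqP/eq_leq/size1_polyC-> : ~~ (size q != 1%N).
    apply/negP => /closed_rootP[s]; rewrite /root => /eqP qs.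
    have := open_inv s x xn k; rewrite ffunE -/q qs eqxx.
    by [].
  by rewrite !hornerC.
have [f [Df0 fE]] := local_slice charK derD nilD D0.
apply: Df0; apply: coord_ring_eq => x.
have [p pE] := coord_ring_poly (D f); rewrite pE /=.
apply: density_points => y yn.
have := fE y 1; rewrite fixed // pE /= mul1r => /eqP.
by rewrite addrC -subr_eq subrr eq_sym => /eqP.
Qed.

End Flow.

(** * Finiteness of the number of orbits *)

Definition orbits_finite (A : set X) := finite_set (@Aut_alg_orbit K X @` A).

Lemma finite_roots_of_one :
  finite_set [set r : 'I_n -> K | forall k, r k ^+ l k = 1].
Proof.
pose rs k := projT1 (closed_field_poly_normal ('X^(l k) - 1%:P : {poly K})).
have rsE k : 'X^(l k) - 1%:P = \prod_(z <- rs k) ('X - z%:P).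
  have := projT2 (closed_field_poly_normal ('X^(l k) - 1%:P : {poly K})).
  by rewrite -/(rs k) (monicP (monicXnsubC _ (l_gt0 k))) scale1r.
pose N := \max_k size (rs k).
pose F (f : {ffun 'I_n -> 'I_N.+1}) k := nth 0 (rs k) (f k).
apply: (@sub_finite_set _ _ (range F)); last exact/finite_image/finite_finset.
move=> r rE; have rin k : r k \in rs k.
  by rewrite -root_prod_XsubC -rsE /root !hornerE rE subrr.
exists [ffun k => inord (index (r k) (rs k))] => //.
apply/funext => k; rewrite /F ffunE inordK ?nth_index // ltnS.
apply: leq_trans (leq_bigmax k); apply: ltnW.
by rewrite index_mem.
Qed.

Hypothesis X_open : exists x : X, open_pt x.

(** Write t as h r with h in Aut_alg and r from a finite set. As r normalises
    Aut_alg, the point x is in the orbit of r y. *)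
Lemma torus_orbit_finite (A : set X) (y : X) :
  (forall x, A x -> exists2 t, torus blk l t &
     exists2 phi : X -> X, @Aut_alg K X phi & x = scale (X := X) t (phi y)) ->
  orbits_finite A.
Proof.
move=> AP; have [e eP] := base_point blk.
apply: (@sub_finite_set _ _
  ((fun r => @Aut_alg_orbit K X (scale (X := X) r y)) @`
     [set r : 'I_n -> K | forall k, r k ^+ l k = 1])); last first.
  exact/finite_image/finite_roots_of_one.
move=> _ [x /AP[t tT [phi phiA xE]] <-].
have [h [r [[hT hA] rE thr]]] := torus_decomposition l_gt0 X_open eP tT.
have rT : torus blk l r.
  split=> [k|i j]; last by rewrite /block_monomial !big1.
  have : r k ^+ l k != 0 by rewrite rE oner_neq0.
  by rewrite expf_eq0 l_gt0.
exists r => //.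
have -> : x = scale (X := X) h
    ((scale (X := X) r \o phi \o scale (X := X) (fun k => (r k)^-1))
     (scale (X := X) r y)).
  rewrite /= (torusVK rT) xE (_ : t = fun k => h k * r k); last exact/funext.
  by rewrite scale_comp //; apply: torus_preserves.
rewrite [RHS]Aut_alg_orbit_eq // [RHS]Aut_alg_orbit_eq //.
apply: Aut_alg_conj phiA; try exact: scale_regular.
- exact/scale_regular/torusV.
- exact: torusVK.
- exact: torusKV.
Qed.

Lemma zero_pattern_finite (Z : {set 'I_n}) :
  orbits_finite [set x : X | Z = [set k | val x k == 0]%SET /\ ~ open_pt x].
Proof.
case: (pselect (exists y : X, Z = [set k | val y k == 0]%SET /\ ~ open_pt y)).
  move=> [y [yZ yn]]; apply: (torus_orbit_finite (y := y)) => x [xZ xn].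
  have yx : same_zeros y x.
    by move=> k; have := xZ; rewrite yZ => /setP/(_ k); rewrite !inE.
  have [k /negP/negPn/eqP yk] : exists k, ~ (val y k != 0) by apply/existsNP.
  have [e ek] := other_block blk1_ex blk2_ex (blk k).
  have [t tT xE] : exists2 t, torus blk l t & x = scale (X := X) t y.
    apply: (same_torus_orbit l_gt0 yx); exists (blk k), (blk e); split.
      by rewrite eq_sym.
    have -> : mu (blk k) (val y) = 0 by apply/eqP/mu_eq0P => //; exists k.
    have -> : mu (blk k) (val x) = 0.
      by apply/eqP/mu_eq0P => //; exists k => //; apply/eqP; rewrite -yx yk.
    by rewrite mul0r mulr0.
  exists t => //; exists id => //.
  by have [] := Aut_alg_subgroup X.
move=> h; rewrite /orbits_finite (_ : [set x | _] = set0) ?image_set0 //.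
by apply/seteqP; split=> // x hx; case: h; exists x.
Qed.

Lemma ratio_finite (c : K) :
  orbits_finite [set x : X | open_pt x /\ mu blk0 (val x) = c * mu blk1 (val x)].
Proof.
case: (pselect (exists y : X, open_pt y /\ mu blk0 (val y) = c * mu blk1 (val y))).
  move=> [y [yn yc]]; apply: (torus_orbit_finite (y := y)) => x [xn xc].
  have yx : same_zeros y x.
    by move=> k; rewrite (negbTE (xn k)) (negbTE (yn k)).
  have [t tT xE] : exists2 t, torus blk l t & x = scale (X := X) t y.
    apply: (same_torus_orbit l_gt0 yx); exists blk0, blk1; split=> //.
    by rewrite xc yc; ring.
  exists t => //; exists id => //.
  by have [] := Aut_alg_subgroup X.
move=> h; rewrite /orbits_finite (_ : [set x | _] = set0) ?image_set0 //.
by apply/seteqP; split=> // x hx; case: h; exists x.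
Qed.

End Trinomial.

Section Assembly.
Variables (K : closedFieldType) (n : nat).
Variables (blk : 'I_n -> 'I_3) (l : 'I_n -> nat).
Hypothesis charK : [pchar K] =i pred0.
Hypothesis l_gt0 : forall k, (0 < l k)%N.
Hypotheses (blk1_ex : exists k, blk k = blk1) (blk2_ex : exists k, blk k = blk2).
Local Notation X := (tri_var K blk l).
Local Notation mu := (block_monomial blk l).

Lemma tri_var_orbits_finite : ~ rigid X -> finite_set (range (@Aut_alg_orbit K X)).
Proof.
move=> nonrigid.
have [D [derD nilD D0]] : exists D : {linear coord_ring X -> coord_ring X},
    [/\ derivation D, locally_nilpotent D & ~ forall f, D f = 0].
  apply: contrapT => h; apply: nonrigid => D dD nD; apply: contrapT => Df0.
  by apply: h; exists D; split=> // D0; apply: Df0.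
pose phi := flow charK derD nilD.
have [x0 [t1 [x0n ne]]] :=
  flow_moves_ratio charK l_gt0 blk1_ex blk2_ex derD nilD D0.
have X_open : exists x : X, open_pt x by exists x0.
have phiA t : @Aut_alg K X (phi t).
  have aP := ga_act_faithful charK derD nilD D0.
  apply: (in_Aut_alg (range_connected_subgroup aP (@ga_connected K))).
  by exists (ga_pt t); rewrite // /ga_act ga_ptK.
(* the monomials along the orbit of x0 *)
pose q i : {poly K} := mu i (fun k => expo nilD (restr (X := X) 'X_k) x0).
have qE i t : (q i).[t] = mu i (val (phi t x0)).
  rewrite /q /block_monomial horner_prod; apply: eq_bigr => k _.
  by rewrite horner_exp ffunE.
have [bad badP] : exists bad : seq K, forall c, c \notin bad ->
    exists t, (q blk1).[t] != 0 /\ (q blk0).[t] = c * (q blk1).[t].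
  apply: (@quotient_values _ _ _ 0 t1).
  by rewrite !qE /phi (flow0 charK derD nilD).
apply: (@sub_finite_set _ _ (
  (\bigcup_(Z in [set: {set 'I_n}]) (@Aut_alg_orbit K X @`
     [set x : X | Z = [set k | val x k == 0]%SET /\ ~ open_pt x])) `|`
  (\bigcup_(c in [set` bad]) (@Aut_alg_orbit K X @`
     [set x : X | open_pt x /\ mu blk0 (val x) = c * mu blk1 (val x)])) `|`
  (@Aut_alg_orbit K X @` [set x : X | open_pt x /\
     mu blk0 (val x) / mu blk1 (val x) \notin bad]))); last first.
  rewrite !finite_setU; split; [split|].
  - by apply: bigcup_finite => [|Z _]; [exact: finite_finset|
      exact: zero_pattern_finite].
  - by apply: bigcup_finite => [|c _]; [exact: finite_seq|exact: ratio_finite].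
  apply: (torus_orbit_finite l_gt0 X_open (y := x0)) => x [xn xbad].
  have [t [q1 q0]] := badP _ xbad; rewrite !qE in q1 q0.
  have m0 i : mu i (val x) != 0 by apply: mu_neq0.
  have prop i j : mu i (val (phi t x0)) * mu j (val x)
                = mu j (val (phi t x0)) * mu i (val x).
    apply: (@proportional_sums _ (fun i => mu i (val (phi t x0)))
      (fun i => mu i (val x)) blk0 blk1) => //; try exact: point_on_tri.
    by rewrite q0 mulrAC divfK // mulrC.
  have zn : open_pt (phi t x0).
    move=> k; apply: contra q1 => /eqP zk.
    rewrite -(inj_eq (mulIf (m0 (blk k)))) mul0r prop.
    have /eqP-> : mu (blk k) (val (phi t x0)) == 0 by apply/mu_eq0P => //; exists k.
    by rewrite mul0r.
  have zx : same_zeros (phi t x0) x.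
    by move=> k; rewrite (negbTE (xn k)) (negbTE (zn k)).
  have [u uT xE] : exists2 u, torus blk l u & x = scale (X := X) u (phi t x0).
    by apply: (same_torus_orbit l_gt0 zx); exists blk0, blk1.
  by exists u => //; exists (phi t).
move=> _ [x _ <-]; case: (pselect (open_pt x)) => xn; last first.
  by left; left; exists [set k | val x k == 0]%SET => //; exists x.
case: (boolP (mu blk0 (val x) / mu blk1 (val x) \in bad)) => xb; last first.
  by right; exists x.
left; right; exists (mu blk0 (val x) / mu blk1 (val x)) => //; exists x => //.
by split=> //; rewrite divfK // mu_neq0.
Qed.

End Assembly.

(** * Trinomials with separated coordinates *)

Section Coordinates.
Variables n0 n1 n2 : nat.

Definition coord_block (T : Type) (a0 : 'I_n0 -> T) (a1 : 'I_n1 -> T)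
    (a2 : 'I_n2 -> T) (k : 'I_(n0 + n1 + n2)) : T :=
  match fintype.split k with
  | inl k' => match fintype.split k' with inl j => a0 j | inr j => a1 j end
  | inr j => a2 j
  end.

Variables (T : Type) (a0 : 'I_n0 -> T) (a1 : 'I_n1 -> T) (a2 : 'I_n2 -> T).

Lemma coord_block0 j : coord_block a0 a1 a2 (lshift n2 (lshift n1 j)) = a0 j.
Proof. by rewrite /coord_block (unsplitK (inl _)) (unsplitK (inl _)). Qed.

Lemma coord_block1 j : coord_block a0 a1 a2 (lshift n2 (rshift n0 j)) = a1 j.
Proof. by rewrite /coord_block (unsplitK (inl _)) (unsplitK (inr _)). Qed.

Lemma coord_block2 j : coord_block a0 a1 a2 (rshift (n0 + n1) j) = a2 j.
Proof. by rewrite /coord_block (unsplitK (inr _)). Qed.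

End Coordinates.

Definition coord_blockE := (coord_block0, coord_block1, coord_block2).

Lemma trinomial_tri_poly (K : closedFieldType) n0 n1 n2
    (l0 : 'I_n0 -> nat) (l1 : 'I_n1 -> nat) (l2 : 'I_n2 -> nat) :
  trinomial K l0 l1 l2 =
  tri_poly K (coord_block (fun=> blk0) (fun=> blk1) (fun=> blk2))
    (coord_block l0 l1 l2).
Proof.
rewrite /tri_poly !big_ord_recr big_ord0 /= add0r /trinomial.
congr (_ + _ + _); rewrite /block_monomial !big_split_ord /=; symmetry.
- rewrite [X in _ * X * _]big1 ?[X in _ * X]big1 ?mulr1.
  + by apply: eq_big => j; rewrite !coord_blockE.
  + by move=> j; rewrite coord_blockE.
  + by move=> j; rewrite coord_blockE.
- rewrite [X in X * _ * _]big1 ?[X in _ * X]big1 ?mulr1 ?mul1r.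
  + by apply: eq_big => j; rewrite !coord_blockE.
  + by move=> j; rewrite coord_blockE.
  + by move=> j; rewrite coord_blockE.
- rewrite [X in X * _ * _]big1 ?[X in _ * X * _]big1 ?mul1r.
  + by apply: eq_big => j; rewrite !coord_blockE.
  + by move=> j; rewrite coord_blockE.
  + by move=> j; rewrite coord_blockE.
Qed.

Theorem theorem4p3 (K : closedFieldType) (charK : [pchar K] =i pred0)
    (n0 n1 n2 : nat) (n1_gt0 : (0 < n1)%N) (n2_gt0 : (0 < n2)%N)
    (l0 : 'I_n0 -> nat) (l1 : 'I_n1 -> nat) (l2 : 'I_n2 -> nat)
    (l0_gt0 : forall j, (0 < l0 j)%N) (l1_gt0 : forall j, (0 < l1 j)%N)
    (l2_gt0 : forall j, (0 < l2 j)%N) :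
  let X := trinomial_hypersurface K l0 l1 l2 in
  ~ rigid X -> finite_set (range (@Aut_alg_orbit K X)).
Proof.
rewrite /trinomial_hypersurface trinomial_tri_poly.
apply: tri_var_orbits_finite => //.
- move=> k; rewrite /coord_block.
  by case: (fintype.split k) => [k'|//]; case: (fintype.split k').
- by exists (lshift n2 (rshift n0 (Ordinal n1_gt0))); rewrite coord_blockE.
- by exists (rshift (n0 + n1) (Ordinal n2_gt0)); rewrite coord_blockE.
Qed.
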